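(* Let $S$ and $T$ be LF theories, let $m:S\to T$ be a theory morphism, and let $r$ be a partial logical relation on $m$, with induced partial map $\bar r$ on $S$-syntax (both as defined in the context). Then: (1) if $\Gamma\vdash_S t:A$ and $\bar r(t)$ is defined, then $\bar r(A)$ is defined and $\bar r(\Gamma)\vdash_T \bar r(t) : \bar r(A)\,\bar m(t)$; (2) if $r$ is term-total, then for every well-typed term $t:A$, $\bar r$ is defined for $t$ whenever it is defined for $A$.
   Context: We work in the logical framework LF (dependently typed $\lambda$-calculus with universes $\mathrm{type},\mathrm{kind}$, dependent function types $\Pi x:A.B$, abstractions $\lambda x:A.t$, applications $f\,t$). An LF theory is a list of constant declarations $c:A$ or $c:A=t$ (each may refer to earlier ones) and includes of previously defined theories (making their constants available). $\Gamma\vdash_T t:A$ denotes LF typing using constants of $T$ and variables of context $\Gamma$. A morphism $m:S\to T$ maps each $S$-constant $c:A$ to a $T$-expression $m(c)$ with $\vdash_T m(c):\bar m(A)$, where $\bar m$ is the homomorphic extension: $\bar m(c)=m(c)$, $\bar m(x)=x$, $\bar m(\mathrm{type})=\mathrm{type}$, $\bar m(\Pi x:A.B)=\Pi x:\bar m(A).\bar m(B)$, $\bar m(\lambda x:A.t)=\lambda x:\bar m(A).\bar m(t)$, $\bar m(f\,t)=\bar m(f)\,\bar m(t)$, and on contexts $\bar m(\cdot)=\cdot$, $\bar m(\Gamma,x:A)=\bar m(\Gamma),x:\bar m(A)$. A partial logical relation $r$ on $m:S\to T$ is a partial map from $S$-constants to $T$-expressions such that for every $S$-constant $c:A$, if $r(c)$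 is defined then $\bar r(A)$ is defined and $\vdash_T r(c):\bar r(A)\,m(c)$. Here $\bar r$ is the partial map on $S$-syntax defined by: $\bar r(c)=r(c)$; $\bar r(x)=x^*$ if a variable $x^*$ was declared when traversing into the binder of $x$, undefined otherwise; $\bar r(\mathrm{type})=\lambda a:\mathrm{type}.\,a\to\mathrm{type}$; $\bar r(\Pi x:A.B)=\lambda f:\bar m(\Pi x:A.B).\,\Pi\,\bar r(x:A).\,\bar r(B)\,(f\,x)$; $\bar r(\lambda x:A.t)=\lambda\,\bar r(x:A).\,\bar r(t)$; $\bar r(f\,t)=\bar r(f)\,\bar m(t)\,\bar r(t)$ if $\bar r(t)$ is defined and $\bar r(f)\,\bar m(t)$ otherwise; on contexts $\bar r(\cdot)=\cdot$ and $\bar r(\Gamma,x:A)=\bar r(\Gamma),x:\bar m(A),x^*:\bar r(A)\,x$ if $\bar r(A)$ is defined and $\bar r(\Gamma),x:\bar m(A)$ otherwise (the notation $\Pi\,\bar r(x:A)$, $\lambda\,\bar r(x:A)$ means binding the one or two variables of this context extension). $\bar r(-)$ is undefined whenever some expression on the right-hand side of its defining clause is undefined. $r$ is term-total if, for every $S$-constant $c:A$, $r(c)$ is defined whenever $\bar r(A)$ is.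
   Formalization: The typing claim in (1) is stated only for term-total r: if r̄(A) is defined but r(c) is not, for some c:A, it fails for (λx:A.x) c. For defined constants c:A=t, m(c) and r(c) must equal m̄(t) and r̄(t), and r(c) must be defined exactly when r̄(t) is. *)

(* Defs.v *)
From Stdlib Require Import List.
Import ListNotations.

(** * Syntax

    Terms, type families and kinds share one syntax with de Bruijn indices.
    The universe [kind] is not an expression: it is the judgment [is_kind]. *)

Definition cname := nat.

Inductive expr : Type :=
| Const (c : cname)
| Var (i : nat)
| Typ
| Pi (A B : expr)
| Lam (A t : expr)
| App (f t : expr).

Definition up_ren (xi : nat -> nat) (i : nat) : nat :=
  match i with 0 => 0 | S j => S (xi j) end.

Fixpoint ren (xi : nat -> nat) (e : expr) : expr :=
  match e with
  | Const c => Const c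
  | Var i => Var (xi i)
  | Typ => Typ
  | Pi A B => Pi (ren xi A) (ren (up_ren xi) B)
  | Lam A t => Lam (ren xi A) (ren (up_ren xi) t)
  | App f t => App (ren xi f) (ren xi t)
  end.

Definition lift (e : expr) : expr := ren S e.

Definition up_sub (sigma : nat -> expr) (i : nat) : expr :=
  match i with 0 => Var 0 | S j => lift (sigma j) end.

Fixpoint sub (sigma : nat -> expr) (e : expr) : expr :=
  match e with
  | Const c => Const c
  | Var i => sigma i
  | Typ => Typ
  | Pi A B => Pi (sub sigma A) (sub (up_sub sigma) B)
  | Lam A t => Lam (sub sigma A) (sub (up_sub sigma) t)
  | App f t => App (sub sigma f) (sub sigma t)
  end.

Definition sub1 (e s : expr) : expr :=
  sub (fun i => match i with 0 => s | S j => Var j end) e.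

(** Innermost variable first; each type lives in the tail that follows it. *)
Definition ctx := list expr.

(** * Theories

    Constant names are global, so that a theory reached through two includes
    contributes its constants once. *)

Inductive theory : Type :=
| TEmpty
| TConst (T : theory) (c : cname) (A : expr) (d : option expr)
| TIncl (T T' : theory).

Fixpoint lookup (T : theory) (c : cname) : option (expr * option expr) :=
  match T with
  | TEmpty => None
  | TConst T' c' A d => if Nat.eqb c c' then Some (A, d) else lookup T' c
  | TIncl T1 T2 =>
      match lookup T1 c with
      | Some e => Some e
      | None => lookup T2 c
      end
  end.

(** * Typing

    LF with typed definitional equality (beta, eta, and delta for defined
    constants).  [has_type T G t A] covers both terms [t] of a type [A] and
    type families [t] of a kind [A]; likewise [eq_expr]. *)

Inductive wf_ctx (T : theory) : ctx -> Prop :=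
| wf_nil : wf_ctx T []
| wf_cons G A : wf_ctx T G -> has_type T G A Typ -> wf_ctx T (A :: G)

with is_kind (T : theory) : ctx -> expr -> Prop :=
| kind_typ G : wf_ctx T G -> is_kind T G Typ
| kind_pi G A K :
    has_type T G A Typ -> is_kind T (A :: G) K -> is_kind T G (Pi A K)

with has_type (T : theory) : ctx -> expr -> expr -> Prop :=
| ty_const G c A d :
    wf_ctx T G -> lookup T c = Some (A, d) -> has_type T G (Const c) A
| ty_var G i A :
    wf_ctx T G -> nth_error G i = Some A ->
    has_type T G (Var i) (ren (fun j => S i + j) A)
| ty_pi G A B :
    has_type T G A Typ -> has_type T (A :: G) B Typ ->
    has_type T G (Pi A B) Typ
| ty_lam G A t B :
    has_type T G A Typ -> has_type T (A :: G) t B ->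
    has_type T G (Lam A t) (Pi A B)
| ty_app G f s A B :
    has_type T G f (Pi A B) -> has_type T G s A ->
    has_type T G (App f s) (sub1 B s)
| ty_conv_type G t A A' :
    has_type T G t A -> eq_expr T G A A' Typ -> has_type T G t A'
| ty_conv_kind G t K K' :
    has_type T G t K -> eq_kind T G K K' -> has_type T G t K'

with eq_kind (T : theory) : ctx -> expr -> expr -> Prop :=
| eqk_refl G K : is_kind T G K -> eq_kind T G K K
| eqk_sym G K K' : eq_kind T G K K' -> eq_kind T G K' K
| eqk_trans G K1 K2 K3 :
    eq_kind T G K1 K2 -> eq_kind T G K2 K3 -> eq_kind T G K1 K3
| eqk_pi G A A' K K' :
    has_type T G A Typ -> eq_expr T G A A' Typ ->
    eq_kind T (A :: G) K K' -> eq_kind T G (Pi A K) (Pi A' K')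

with eq_expr (T : theory) : ctx -> expr -> expr -> expr -> Prop :=
| eqe_refl G t A : has_type T G t A -> eq_expr T G t t A
| eqe_sym G t u A : eq_expr T G t u A -> eq_expr T G u t A
| eqe_trans G t u v A :
    eq_expr T G t u A -> eq_expr T G u v A -> eq_expr T G t v A
| eqe_pi G A A' B B' :
    has_type T G A Typ -> eq_expr T G A A' Typ ->
    eq_expr T (A :: G) B B' Typ -> eq_expr T G (Pi A B) (Pi A' B') Typ
| eqe_lam G A A' t t' B :
    has_type T G A Typ -> eq_expr T G A A' Typ ->
    eq_expr T (A :: G) t t' B -> eq_expr T G (Lam A t) (Lam A' t') (Pi A B)
| eqe_app G f f' s s' A B :
    eq_expr T G f f' (Pi A B) -> eq_expr T G s s' A ->
    eq_expr T G (App f s) (App f' s') (sub1 B s)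
| eqe_beta G A t B s :
    has_type T G A Typ -> has_type T (A :: G) t B -> has_type T G s A ->
    eq_expr T G (App (Lam A t) s) (sub1 t s) (sub1 B s)
| eqe_eta G f A B :
    has_type T G f (Pi A B) ->
    eq_expr T G (Lam A (App (lift f) (Var 0))) f (Pi A B)
| eqe_delta G c A t :
    wf_ctx T G -> lookup T c = Some (A, Some t) ->
    eq_expr T G (Const c) t A
| eqe_conv_type G t u A A' :
    eq_expr T G t u A -> eq_expr T G A A' Typ -> eq_expr T G t u A'
| eqe_conv_kind G t u K K' :
    eq_expr T G t u K -> eq_kind T G K K' -> eq_expr T G t u K'.

Inductive wf_theory : theory -> Prop :=
| wft_empty : wf_theory TEmpty
| wft_const T c A d :
    wf_theory T -> lookup T c = None ->
    has_type T [] A Typ \/ is_kind T [] A ->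
    (forall t, d = Some t -> has_type T [] t A) ->
    wf_theory (TConst T c A d)
| wft_incl T T' :
    wf_theory T -> wf_theory T' ->
    (forall c e e', lookup T c = Some e -> lookup T' c = Some e' -> e = e') ->
    wf_theory (TIncl T T').

(** * Morphisms *)

Fixpoint mbar (m : cname -> expr) (e : expr) : expr :=
  match e with
  | Const c => m c
  | Var i => Var i
  | Typ => Typ
  | Pi A B => Pi (mbar m A) (mbar m B)
  | Lam A t => Lam (mbar m A) (mbar m t)
  | App f t => App (mbar m f) (mbar m t)
  end.

(** Defined constants must go to their definientia, since otherwise [mbar m]
    does not respect the delta rule.  Values of [m] outside [S] are
    irrelevant. *)
Definition is_morphism (S T : theory) (m : cname -> expr) : Prop :=
  forall c A d, lookup S c = Some (A, d) ->
    has_type T [] (m c) (mbar m A) /\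
    (forall t, d = Some t -> eq_expr T [] (m c) (mbar m t) (mbar m A)).

(** * Logical relations

    Since [x] and [x^*] are separate target variables, a source variable [i]
    has target index [obj E i], and [star E i] is the index of its [x^*] if
    one was declared. *)

Record renv := mk_renv { obj : nat -> nat; star : nat -> option nat }.

Definition renv0 : renv := mk_renv (fun i => i) (fun _ => None).

(** One more target variable, corresponding to no source variable. *)
Definition shift (E : renv) : renv :=
  mk_renv (fun i => S (obj E i)) (fun i => option_map S (star E i)).

(** The environment after [x : m(A)] or, if [b], after
    [x : m(A), x^* : r(A) x]. *)
Definition ext (b : bool) (E : renv) : renv :=
  if b then
    mk_renv (fun i => match i with 0 => 1 | S j => S (S (obj E j)) end)
            (fun i => match i with
                      | 0 => Some 0
                      | S j => option_map (fun k => S (S k)) (star E j)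
                      end)
  else
    mk_renv (fun i => match i with 0 => 0 | S j => S (obj E j) end)
            (fun i => match i with
                      | 0 => None
                      | S j => option_map S (star E j)
                      end).

Definition defined (o : option expr) : bool :=
  match o with Some _ => true | None => false end.

Definition mor (m : cname -> expr) (E : renv) (e : expr) : expr :=
  ren (obj E) (mbar m e).

(** [bind Q A ra body], for [Q] one of [Pi] and [Lam], binds [x : A] and, if
    [ra = Some a], also [x^* : a x]. *)
Definition bind (Q : expr -> expr -> expr)
    (A : expr) (ra : option expr) (body : expr) : expr :=
  match ra with
  | Some a => Q A (Q (App (lift a) (Var 0)) body)
  | None => Q A body
  end.

(** In the [Pi] clause the subterms are translated below the extra target
    binder [f], which [bind] moves to index 2 or 1, with [x] at 1 or 0.
    In the last [App] clause, if [r] is defined on the type of [t] but not on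
    [t], then [f'] expects two arguments and gets one, so the result does not
    have the expected type.  [term_total] below excludes this. *)
Fixpoint rbar (m : cname -> expr) (r : cname -> option expr)
    (E : renv) (e : expr) : option expr :=
  match e with
  | Const c => r c
  | Var i => option_map Var (star E i)
  | Typ => Some (Lam Typ (Pi (Var 0) Typ))
  | Pi A B =>
      let F := shift E in
      let ra := rbar m r F A in
      let b := defined ra in
      let fx := if b then App (Var 2) (Var 1) else App (Var 1) (Var 0) in
      option_map
        (fun rb => Lam (mor m E (Pi A B)) (bind Pi (mor m F A) ra (App rb fx)))
        (rbar m r (ext b F) B)
  | Lam A t =>
      let ra := rbar m r E A in
      option_map (bind Lam (mor m E A) ra) (rbar m r (ext (defined ra) E) t)
  | App f t =>
      match rbar m r E f, rbar m r E t with
      | None, _ => None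
      | Some f', Some t' => Some (App (App f' (mor m E t)) t')
      | Some f', None => Some (App f' (mor m E t))
      end
  end.

Fixpoint renv_of (m : cname -> expr) (r : cname -> option expr)
    (G : ctx) : renv :=
  match G with
  | [] => renv0
  | A :: G' =>
      let E := renv_of m r G' in ext (defined (rbar m r E A)) E
  end.

Fixpoint rctx (m : cname -> expr) (r : cname -> option expr)
    (G : ctx) : ctx :=
  match G with
  | [] => []
  | A :: G' =>
      let E := renv_of m r G' in
      match rbar m r E A with
      | Some a => App (lift a) (Var 0) :: mor m E A :: rctx m r G'
      | None => mor m E A :: rctx m r G'
      end
  end.

(** For a kind [K], the expression [r(K) m(t)] is not an LF kind, because
    [r(K)] abstracts over type families: [r(type) A] is
    [(fun a : type => a -> type) A].  It stands for its beta-reduct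
    [A -> type].  [kind_red] contracts exactly those redexes; it never
    succeeds on a type, as a type does not end in [Typ]. *)
Inductive kind_red : expr -> expr -> Prop :=
| kr_typ : kind_red Typ Typ
| kr_pi A B K : kind_red B K -> kind_red (Pi A B) (Pi A K)
| kr_beta A t s K : kind_red (sub1 t s) K -> kind_red (App (Lam A t) s) K.

Definition has_type_red (T : theory) (G : ctx) (t C : expr) : Prop :=
  has_type T G t C \/ exists K, kind_red C K /\ has_type T G t K.

Definition eq_expr_red (T : theory) (G : ctx) (t u C : expr) : Prop :=
  eq_expr T G t u C \/ exists K, kind_red C K /\ eq_expr T G t u K.

(** On a constant with a definiens, [r] must agree with [rbar] of the
    definiens, including where it is defined, since otherwise [rbar] does not
    respect the delta rule. *)
Definition partial_logrel (S T : theory) (m : cname -> expr)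
    (r : cname -> option expr) : Prop :=
  forall c A d, lookup S c = Some (A, d) ->
    (forall rc, r c = Some rc ->
       exists rA, rbar m r renv0 A = Some rA /\
         has_type_red T [] rc (App rA (m c))) /\
    (forall t, d = Some t ->
       (r c <> None <-> rbar m r renv0 t <> None) /\
       (forall rc rt rA, r c = Some rc -> rbar m r renv0 t = Some rt ->
          rbar m r renv0 A = Some rA ->
          eq_expr_red T [] rc rt (App rA (m c)))).

(** Totality on the constants whose classifier is a type.  Type families are
    exempt: [rbar] is defined on every kind, so including them would force
    [r] to be total. *)
Definition term_total (S : theory) (m : cname -> expr)
    (r : cname -> option expr) : Prop :=
  forall c A d, lookup S c = Some (A, d) -> has_type S [] A Typ ->
    rbar m r renv0 A <> None -> r c <> None.

Definition const_total (S : theory) (m : cname -> expr)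
    (r : cname -> option expr) : Prop :=
  forall c A d, lookup S c = Some (A, d) ->
    rbar m r renv0 A <> None -> r c <> None.

(* Main.v *)
(** In a kind or type family, [rbar] is defined or not according to the head
    constant, since variables are never type families.  Hence definedness is
    invariant under conversion of classifiers, and an induction on derivations
    shows that [rbar] is defined on the classifier of a term whenever it is
    defined on the term, the converse being term totality.

    For the typing of [rbar t], write [Rel A f] for [rbar A] applied to [f],
    beta-reduced if [A] is a kind.  One shows by induction on derivations that
    [t : A] implies [rbar t : Rel A (m t)], that equal terms have equal images,
    and that equal classifiers have equal relations.  The induction needs the
    hypothesis for the classifiers occurring in a derivation as well, which the
    rules do not provide as premises.  So derivations are first annotated with
    these presuppositions; that this is possible is the substitution,
    functionality and regularity metatheory of LF.  Under term totality [rbar]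
    is defined on [s : A] iff it is on [A], so that binders and arguments always
    agree on whether there is an [x^*], which makes [rbar] commute with
    substitution. *)
Require Import Defs.
From Stdlib Require Import List Lia Arith Bool.
Import ListNotations.

(** Typing and equality of images are proved as one statement. The predicate [sem G t u C] is an
    equality judgment of the target theory, and the typing of the image of [t] is its diagonal
    [sem G t t C]; so a typing rule and the matching congruence rule share one lemma. A kind has no
    classifier at which its image could be typed, so at kinds [sem] compares instead the relations
    that the two kinds induce on equal target families.

    Definedness has to be settled before any typing, because it fixes the shape of every translated
    context: each binder contributes one or two target variables. It must also be readable without
    an environment, since conversion and substitution change the environment. Terms and families
    need different tests: a family is tested by its own head, a term by the head of its type, as its
    own head may be a variable.

    The classifier of an image mentions [mor t] itself. Hence symmetry, transitivity, beta and eta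
    all change the classifier, and each such case needs that a relation respects equality of its
    argument. *)

Lemma ren_ext xi zeta e : (forall i, xi i = zeta i) -> ren xi e = ren zeta e.
Proof.
  revert xi zeta; induction e; intros xi zeta H; simpl; f_equal; auto;
    match goal with IH : _ |- ren (up_ren _) _ = _ => apply IH end;
    intros [|j]; simpl; auto.
Qed.

Lemma sub_ext sigma tau e : (forall i, sigma i = tau i) -> sub sigma e = sub tau e.
Proof.
  revert sigma tau; induction e; intros sigma tau H; simpl; f_equal; auto;
    match goal with IH : _ |- sub (up_sub _) _ = _ => apply IH end;
    intros [|j]; simpl; unfold lift; f_equal; auto.
Qed.

(** Composition laws are bootstrapped in the usual order: substitution after renaming, renaming
    after substitution, and then two substitutions, each using the previous ones under binders. *)
Lemma ren_as_sub xi e : ren xi e = sub (fun i => Var (xi i)) e.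
Proof.
  revert xi; induction e; intros xi; simpl; f_equal; auto;
    match goal with IH : _ |- ren (up_ren _) _ = _ => rewrite IH end;
    apply sub_ext; intros [|j]; reflexivity.
Qed.

Lemma sub_var e : sub Var e = e.
Proof.
  induction e; simpl; f_equal; auto;
    match goal with IH : sub Var ?e = ?e |- sub (up_sub _) ?e = _ =>
      rewrite <- IH at 2 end;
    apply sub_ext; intros [|j]; reflexivity.
Qed.

Lemma sub_ren xi sigma e : sub sigma (ren xi e) = sub (fun i => sigma (xi i)) e.
Proof.
  revert xi sigma; induction e; intros xi sigma; simpl; f_equal; auto;
    match goal with IH : _ |- sub (up_sub _) (ren _ _) = _ => rewrite IH end;
    apply sub_ext; intros [|j]; reflexivity.
Qed.

Lemma ren_ren xi zeta e : ren zeta (ren xi e) = ren (fun i => zeta (xi i)) e.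
Proof. now rewrite ren_as_sub, sub_ren, <- ren_as_sub. Qed.

Lemma ren_sub xi sigma e : ren xi (sub sigma e) = sub (fun i => ren xi (sigma i)) e.
Proof.
  revert xi sigma; induction e; intros xi sigma; simpl; f_equal; auto;
    match goal with IH : _ |- ren (up_ren _) (sub _ _) = _ => rewrite IH end;
    apply sub_ext; intros [|j]; simpl; unfold lift; rewrite ?ren_ren; reflexivity.
Qed.

Lemma sub_sub sigma tau e : sub tau (sub sigma e) = sub (fun i => sub tau (sigma i)) e.
Proof.
  revert sigma tau; induction e; intros sigma tau; simpl; f_equal; auto;
    match goal with IH : _ |- sub (up_sub _) (sub _ _) = _ => rewrite IH end;
    apply sub_ext; intros [|j]; simpl; unfold lift; rewrite ?sub_ren, ?ren_sub;
    reflexivity.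
Qed.

Lemma ren_sub1 xi e s : ren xi (sub1 e s) = sub1 (ren (up_ren xi) e) (ren xi s).
Proof.
  unfold sub1; rewrite ren_sub, sub_ren; apply sub_ext; intros [|j]; reflexivity.
Qed.

Lemma sub_lift sigma e : sub (up_sub sigma) (lift e) = lift (sub sigma e).
Proof. unfold lift; rewrite sub_ren, ren_sub; reflexivity. Qed.

Lemma ren_lift xi e : ren (up_ren xi) (lift e) = lift (ren xi e).
Proof. unfold lift; now rewrite !ren_ren. Qed.

Lemma sub1_lift e s : sub1 (lift e) s = e.
Proof. unfold sub1, lift; rewrite sub_ren; apply sub_var. Qed.

Lemma sub_sub1 sigma e s : sub sigma (sub1 e s) = sub1 (sub (up_sub sigma) e) (sub sigma s).
Proof.
  unfold sub1; rewrite !sub_sub; apply sub_ext; intros [|j]; simpl; auto.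
  unfold lift; rewrite sub_ren; symmetry; apply sub_var.
Qed.

Lemma sub1_up_lift e : sub1 (ren (up_ren S) e) (Var 0) = e.
Proof.
  unfold sub1; rewrite sub_ren; rewrite <- (sub_var e) at 2.
  apply sub_ext; intros [|j]; reflexivity.
Qed.

(** Invariance under all substitutions, instead of a bound on the free variables, can be used
    directly as a rewrite rule. *)
Definition closed (e : expr) : Prop := forall sigma, sub sigma e = e.

Lemma closed_ren e xi : closed e -> ren xi e = e.
Proof. intros H; rewrite ren_as_sub; apply H. Qed.

Definition closed_theory (T : theory) : Prop :=
  forall c A d, lookup T c = Some (A, d) ->
    closed A /\ forall t, d = Some t -> closed t.

(** These are the two classifiers that a classifier can have: none for a kind, [Typ] for a type.
    Rules that exist once for types and once for kinds are merged by quantifying over [s]. *)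
Definition sort (s : option expr) : Prop := s = None \/ s = Some Typ.

Lemma sort_kind : sort None.
Proof. now left. Qed.

Lemma sort_type : sort (Some Typ).
Proof. now right. Qed.

Lemma sort_map f s : sort s -> f Typ = Typ -> option_map f s = s.
Proof. intros [-> | ->] H; simpl; now rewrite ?H. Qed.

#[local] Hint Resolve sort_kind sort_type : core.

(** * Annotated derivations

    [aty T G t None] says that [t] is a kind, and [aty T G t (Some A)] that it
    has classifier [A]; likewise [aeq].  Every rule carries the presuppositions
    of its conclusion as premises, so that an induction on a derivation in the
    source theory provides the induction hypothesis for the classifiers too. *)

Inductive awf (T : theory) : ctx -> Prop :=
| awf_nil : awf T []
| awf_cons G A : awf T G -> aty T G A (Some Typ) -> awf T (A :: G)

with aok (T : theory) : ctx -> option expr -> Prop :=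
| aok_none G : awf T G -> aok T G None
| aok_some G A s : sort s -> aty T G A s -> aok T G (Some A)

with aty (T : theory) : ctx -> expr -> option expr -> Prop :=
| aty_typ G : awf T G -> aty T G Typ None
| aty_const G c A d :
    awf T G -> lookup T c = Some (A, d) -> aok T G (Some A) ->
    aty T G (Const c) (Some A)
| aty_var G i A :
    awf T G -> nth_error G i = Some A ->
    aok T G (Some (ren (fun j => S i + j) A)) ->
    aty T G (Var i) (Some (ren (fun j => S i + j) A))
| aty_pi G A B s :
    sort s -> aty T G A (Some Typ) -> aty T (A :: G) B s -> aty T G (Pi A B) s
| aty_lam G A t B :
    aty T G A (Some Typ) -> aok T (A :: G) (Some B) ->
    aok T G (Some (Pi A B)) -> aty T (A :: G) t (Some B) ->
    aty T G (Lam A t) (Some (Pi A B))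
| aty_app G f a A B :
    aty T G A (Some Typ) -> aok T (A :: G) (Some B) ->
    aok T G (Some (sub1 B a)) ->
    aty T G f (Some (Pi A B)) -> aty T G a (Some A) ->
    aty T G (App f a) (Some (sub1 B a))
| aty_conv G t A A' s :
    sort s -> aty T G A s -> aty T G A' s ->
    aty T G t (Some A) -> aeq T G A A' s -> aty T G t (Some A')

with aeq (T : theory) : ctx -> expr -> expr -> option expr -> Prop :=
| aeq_refl G t C : aok T G C -> aty T G t C -> aeq T G t t C
| aeq_sym G t u C :
    aok T G C -> aty T G t C -> aty T G u C -> aeq T G t u C -> aeq T G u t C
| aeq_trans G t u v C :
    aok T G C -> aty T G t C -> aty T G u C -> aty T G v C ->
    aeq T G t u C -> aeq T G u v C -> aeq T G t v C
| aeq_pi G A A' B B' s :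
    sort s -> aok T G s -> aty T G (Pi A B) s -> aty T G (Pi A' B') s ->
    aty T G A (Some Typ) -> aty T (A :: G) B s ->
    aeq T G A A' (Some Typ) -> aeq T (A :: G) B B' s ->
    aeq T G (Pi A B) (Pi A' B') s
| aeq_lam G A A' t t' B :
    aok T G (Some (Pi A B)) ->
    aty T G (Lam A t) (Some (Pi A B)) -> aty T G (Lam A' t') (Some (Pi A B)) ->
    aty T G A (Some Typ) -> aok T (A :: G) (Some B) ->
    aeq T G A A' (Some Typ) -> aeq T (A :: G) t t' (Some B) ->
    aeq T G (Lam A t) (Lam A' t') (Some (Pi A B))
| aeq_app G f f' a a' A B :
    aok T G (Some (sub1 B a)) ->
    aty T G (App f a) (Some (sub1 B a)) ->
    aty T G (App f' a') (Some (sub1 B a)) ->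
    aty T G A (Some Typ) -> aok T (A :: G) (Some B) ->
    aeq T G f f' (Some (Pi A B)) -> aeq T G a a' (Some A) ->
    aeq T G (App f a) (App f' a') (Some (sub1 B a))
| aeq_beta G A t B a :
    aok T G (Some (sub1 B a)) ->
    aty T G (App (Lam A t) a) (Some (sub1 B a)) ->
    aty T G (sub1 t a) (Some (sub1 B a)) ->
    aty T G A (Some Typ) -> aok T (A :: G) (Some B) ->
    aty T (A :: G) t (Some B) -> aty T G a (Some A) ->
    aeq T G (App (Lam A t) a) (sub1 t a) (Some (sub1 B a))
| aeq_eta G f A B :
    aok T G (Some (Pi A B)) ->
    aty T G (Lam A (App (lift f) (Var 0))) (Some (Pi A B)) ->
    aty T G A (Some Typ) -> aok T (A :: G) (Some B) ->
    aty T G f (Some (Pi A B)) ->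
    aeq T G (Lam A (App (lift f) (Var 0))) f (Some (Pi A B))
| aeq_delta G c A t :
    awf T G -> aok T G (Some A) -> aty T G (Const c) (Some A) -> aty T G t (Some A) ->
    lookup T c = Some (A, Some t) -> aeq T G (Const c) t (Some A)
| aeq_conv G t u A A' s :
    sort s -> aty T G A s -> aty T G A' s ->
    aty T G t (Some A') -> aty T G u (Some A') ->
    aeq T G t u (Some A) -> aeq T G A A' s -> aeq T G t u (Some A').

Scheme awf_mut := Minimality for awf Sort Prop
with aok_mut := Minimality for aok Sort Prop
with aty_mut := Minimality for aty Sort Prop
with aeq_mut := Minimality for aeq Sort Prop.
Combined Scheme annotated_ind from awf_mut, aok_mut, aty_mut, aeq_mut.

(* Instantiates the induction hypotheses of the closure proofs below, first in
   the ambient context and then, through [up], under a binder. *)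
Ltac closure_ih T ok up act Hs :=
  repeat match goal with
  | H : forall D x, awf T D -> ok D x ?G -> _, HD : awf T ?D0, HR : ok ?D0 ?x0 ?G |- _ =>
      specialize (H D0 x0 HD HR)
  end;
  repeat match goal with H : sort ?s |- _ =>
    progress rewrite (fun x => Hs s x H) in * end;
  try match goal with
  | H : forall D x, awf T D -> ok D x (?A :: ?G) -> _, HR : ok ?D0 ?x0 ?G |- _ =>
      assert (awf T (act x0 A :: D0)) by (constructor; auto)
  end;
  repeat match goal with
  | H : forall D x, awf T D -> ok D x (?A :: ?G) -> _,
    HD : awf T (act ?x0 ?A :: ?D0), HR : ok ?D0 ?x0 ?G |- _ =>
      specialize (H _ _ HD ltac:(apply up; auto))
  end;
  repeat match goal with H : sort ?s |- _ =>
    progress rewrite (fun x => Hs s x H) in * end.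

(** * Renaming, substitution and functionality for annotated derivations *)

Section Metatheory.

Variable T : theory.

Lemma aok_sort G s : awf T G -> sort s -> aok T G s.
Proof.
  intros HG [-> | ->]; [now constructor | eapply aok_some; [|now constructor]; auto].
Qed.

Lemma awf_of :
  (forall G, awf T G -> True) /\
  (forall G C, aok T G C -> awf T G) /\
  (forall G t C, aty T G t C -> awf T G) /\
  (forall G t u C, aeq T G t u C -> awf T G).
Proof. apply annotated_ind; auto. Qed.

Lemma aty_wf G t C : aty T G t C -> awf T G.
Proof. apply awf_of. Qed.

Lemma aty_ok G t C : aty T G t C -> aok T G C.
Proof.
  intros H; inversion H; subst; auto using aok_none.
  - apply aok_sort; auto. eapply aty_wf; eauto.
  - eapply aok_some; eauto.
Qed.

(** Regularity is a mere inversion here, because every equality rule carries the typing of both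
    sides as premises. *)
Lemma aeq_valid G t u C :
  aeq T G t u C -> aok T G C /\ aty T G t C /\ aty T G u C.
Proof.
  intros H; inversion H; subst; auto.
  repeat split; auto. eapply aok_some; eauto.
Qed.

Hypothesis HT : closed_theory T.

(** The two declared types live in different tails, so they are compared after weakening to the full
    contexts, the form in which the variable rule delivers them. *)
Definition ren_ok (D : ctx) (xi : nat -> nat) (G : ctx) : Prop :=
  forall i A, nth_error G i = Some A ->
    exists A', nth_error D (xi i) = Some A' /\
      ren (fun j => S (xi i) + j) A' = ren xi (ren (fun j => S i + j) A).

Lemma ren_ok_up D xi G A :
  ren_ok D xi G -> ren_ok (ren xi A :: D) (up_ren xi) (A :: G).
Proof.
  intros H [|i] B; simpl; intros HB.
  - injection HB as <-; eexists; split; [reflexivity|].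
    rewrite !ren_ren; apply ren_ext; reflexivity.
  - destruct (H i B HB) as (B' & HB' & E); exists B'; split; auto.
    transitivity (lift (ren (fun j => S (xi i) + j) B')).
    + unfold lift; rewrite ren_ren; apply ren_ext; reflexivity.
    + rewrite E; unfold lift; rewrite !ren_ren; apply ren_ext; reflexivity.
Qed.

Lemma ren_ok_S D A : ren_ok (A :: D) S D.
Proof.
  intros i B H; exists B; split; auto. rewrite ren_ren; apply ren_ext; reflexivity.
Qed.

Lemma annotated_ren :
  (forall G, awf T G -> True) /\
  (forall G C, aok T G C -> forall D xi, awf T D -> ren_ok D xi G ->
     aok T D (option_map (ren xi) C)) /\
  (forall G t C, aty T G t C -> forall D xi, awf T D -> ren_ok D xi G ->
     aty T D (ren xi t) (option_map (ren xi) C)) /\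
  (forall G t u C, aeq T G t u C -> forall D xi, awf T D -> ren_ok D xi G ->
     aeq T D (ren xi t) (ren xi u) (option_map (ren xi) C)).
Proof.
  assert (Hs : forall s xi, sort s -> option_map (ren xi) s = s)
    by (intros; now apply sort_map).
  apply annotated_ind; auto.
  all: intros; closure_ih T ren_ok ren_ok_up ren Hs;
    cbn [option_map ren up_ren] in *; rewrite ?ren_sub1, ?ren_lift in *.
  - now constructor.
  - econstructor; eauto.
  - now constructor.
  - match goal with H : lookup T c = _ |- _ => destruct (HT _ _ _ H) as [HA _] end.
    rewrite (closed_ren _ _ HA) in *.
    econstructor; eauto.
  - match goal with
    | H : nth_error G i = _, HR : ren_ok _ _ G |- _ =>
        destruct (HR _ _ H) as (A' & HA' & E)
    end.
    rewrite <- E in *; apply aty_var; auto.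
  - apply aty_pi; auto.
  - apply aty_lam; auto.
  - eapply aty_app; eauto.
  - apply aty_conv with (ren xi A) s; auto.
  - apply aeq_refl; auto.
  - apply aeq_sym; auto.
  - apply aeq_trans with (ren xi u); auto.
  - apply aeq_pi; auto.
  - apply aeq_lam; auto.
  - eapply aeq_app; eauto.
  - eapply aeq_beta; eauto.
  - eapply aeq_eta; eauto.
  - match goal with H : lookup T c = _ |- _ => destruct (HT _ _ _ H) as [HA Ht] end.
    specialize (Ht _ eq_refl).
    rewrite (closed_ren _ _ HA), (closed_ren _ _ Ht) in *. apply aeq_delta; auto.
  - apply aeq_conv with (ren xi A) s; auto.
Qed.

Lemma aty_lift G A t C :
  aty T G A (Some Typ) -> aty T G t C -> aty T (A :: G) (lift t) (option_map lift C).
Proof.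
  intros HA Ht; apply annotated_ren with (G := G); auto using ren_ok_S.
  constructor; auto; eapply aty_wf; eauto.
Qed.

Lemma aeq_lift G A t u C :
  aty T G A (Some Typ) -> aeq T G t u C ->
  aeq T (A :: G) (lift t) (lift u) (option_map lift C).
Proof.
  intros HA Ht; apply annotated_ren with (G := G); auto using ren_ok_S.
  constructor; auto; eapply aty_wf; eauto.
Qed.

Lemma aty_var0 G A :
  aty T G A (Some Typ) -> aty T (A :: G) (Var 0) (Some (lift A)).
Proof.
  intros HA.
  assert (H : aok T (A :: G) (Some (lift A))).
  { eapply aok_some; [auto|]. apply (aty_lift _ _ _ (Some Typ)); eauto. }
  change (lift A) with (ren (fun j => S 0 + j) A).
  apply aty_var; auto. constructor; auto; eapply aty_wf; eauto.
Qed.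

Definition sub_ok (D : ctx) (sigma : nat -> expr) (G : ctx) : Prop :=
  forall i A, nth_error G i = Some A ->
    aty T D (sigma i) (Some (sub sigma (ren (fun j => S i + j) A))).

Lemma sub_up_var sigma i A :
  sub (up_sub sigma) (ren (fun j => S (S i) + j) A)
  = lift (sub sigma (ren (fun j => S i + j) A)).
Proof.
  rewrite <- sub_lift; f_equal; unfold lift; rewrite ren_ren; apply ren_ext; reflexivity.
Qed.

Lemma sub_ok_up D sigma G A :
  sub_ok D sigma G -> aty T D (sub sigma A) (Some Typ) ->
  sub_ok (sub sigma A :: D) (up_sub sigma) (A :: G).
Proof.
  intros H HA [|i] B HB; simpl in HB.
  - injection HB as <-. change (ren _ A) with (lift A).
    rewrite sub_lift; now apply aty_var0.
  - rewrite sub_up_var. apply (aty_lift _ _ _ (Some _)); auto.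
Qed.

Lemma annotated_sub :
  (forall G, awf T G -> True) /\
  (forall G C, aok T G C -> forall D sigma, awf T D -> sub_ok D sigma G ->
     aok T D (option_map (sub sigma) C)) /\
  (forall G t C, aty T G t C -> forall D sigma, awf T D -> sub_ok D sigma G ->
     aty T D (sub sigma t) (option_map (sub sigma) C)) /\
  (forall G t u C, aeq T G t u C -> forall D sigma, awf T D -> sub_ok D sigma G ->
     aeq T D (sub sigma t) (sub sigma u) (option_map (sub sigma) C)).
Proof.
  assert (Hs : forall s sigma, sort s -> option_map (sub sigma) s = s)
    by (intros; now apply sort_map).
  apply annotated_ind; auto.
  all: intros; closure_ih T sub_ok sub_ok_up sub Hs;
    cbn [option_map sub up_sub] in *; rewrite ?sub_sub1, ?sub_lift in *.
  - now constructor.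
  - econstructor; eauto.
  - now constructor.
  - match goal with H : lookup T c = _ |- _ => destruct (HT _ _ _ H) as [HA _] end.
    rewrite HA in *.
    econstructor; eauto.
  - auto.
  - apply aty_pi; auto.
  - apply aty_lam; auto.
  - eapply aty_app; eauto.
  - apply aty_conv with (sub sigma A) s; auto.
  - apply aeq_refl; auto.
  - apply aeq_sym; auto.
  - apply aeq_trans with (sub sigma u); auto.
  - apply aeq_pi; auto.
  - apply aeq_lam; auto.
  - eapply aeq_app; eauto.
  - eapply aeq_beta; eauto.
  - eapply aeq_eta; eauto.
  - match goal with H : lookup T c = _ |- _ => destruct (HT _ _ _ H) as [HA Ht] end.
    specialize (Ht _ eq_refl). rewrite HA, Ht in *. apply aeq_delta; auto.
  - apply aeq_conv with (sub sigma A) s; auto.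
Qed.

Definition sub_eq (D : ctx) (sigma tau : nat -> expr) (G : ctx) : Prop :=
  sub_ok D sigma G /\ sub_ok D tau G /\
  forall i A, nth_error G i = Some A ->
    aeq T D (sigma i) (tau i) (Some (sub sigma (ren (fun j => S i + j) A))).

(* A prime marks a rule without the presupposition premises. *)
Lemma aeq_sym' G t u C : aeq T G t u C -> aeq T G u t C.
Proof. intros H; destruct (aeq_valid _ _ _ _ H) as (? & ? & ?); now apply aeq_sym. Qed.

Lemma aeq_trans' G t u v C : aeq T G t u C -> aeq T G u v C -> aeq T G t v C.
Proof.
  intros H H'; destruct (aeq_valid _ _ _ _ H) as (? & ? & ?),
    (aeq_valid _ _ _ _ H') as (? & ? & ?); now apply aeq_trans with u.
Qed.

Lemma aeq_refl' G t C : aty T G t C -> aeq T G t t C.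
Proof. intros H; apply aeq_refl; auto. eapply aty_ok; eauto. Qed.

Lemma aty_conv' G t A A' s :
  sort s -> aty T G t (Some A) -> aeq T G A A' s -> aty T G t (Some A').
Proof.
  intros Hs H H'; destruct (aeq_valid _ _ _ _ H') as (? & ? & ?).
  now apply aty_conv with A s.
Qed.

Lemma aeq_conv' G t u A A' s :
  sort s -> aeq T G t u (Some A) -> aeq T G A A' s -> aeq T G t u (Some A').
Proof.
  intros Hs H H'; destruct (aeq_valid _ _ _ _ H) as (? & ? & ?),
    (aeq_valid _ _ _ _ H') as (? & ? & ?).
  apply aeq_conv with A s; auto; eapply aty_conv'; eauto.
Qed.

Lemma sub_eq_up D sigma tau G A :
  awf T D -> sub_eq D sigma tau G ->
  aeq T D (sub sigma A) (sub tau A) (Some Typ) ->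
  sub_eq (sub sigma A :: D) (up_sub sigma) (up_sub tau) (A :: G).
Proof.
  intros HD (Hs & Ht & E) HA.
  destruct (aeq_valid _ _ _ _ HA) as (_ & HsA & HtA).
  repeat split.
  - now apply sub_ok_up.
  - intros [|i] B HB; simpl in HB.
    + injection HB as <-. change (ren _ A) with (lift A).
      rewrite sub_lift; eapply aty_conv'; [|now apply aty_var0|]; eauto.
      now apply (aeq_lift _ _ _ _ (Some Typ)).
    + rewrite sub_up_var. apply (aty_lift _ _ _ (Some _)); auto.
  - intros [|i] B HB; simpl in HB.
    + injection HB as <-. change (ren _ A) with (lift A).
      rewrite sub_lift; now apply aeq_refl', aty_var0.
    + rewrite sub_up_var. apply (aeq_lift _ _ _ _ (Some _)); auto.
Qed.

(** Typed expressions suffice: for equal [t] and [u], apply one substitution to the equation by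
    [annotated_sub] and then change the substitution in [u]. The instance under [tau] must be typed
    at the instance of the classifier under [sigma], which is why equality of the classifier's
    instances is part of the induction. *)
Lemma functionality :
  (forall G, awf T G -> True) /\
  (forall G C, aok T G C -> forall D sigma tau, awf T D -> sub_eq D sigma tau G ->
     forall A, C = Some A -> exists s, sort s /\ aeq T D (sub sigma A) (sub tau A) s) /\
  (forall G t C, aty T G t C -> forall D sigma tau, awf T D -> sub_eq D sigma tau G ->
     aeq T D (sub sigma t) (sub tau t) (option_map (sub sigma) C)) /\
  (forall G t u C, aeq T G t u C -> True).
Proof.
  assert (Hs : forall s sigma, sort s -> option_map (sub sigma) s = s)
    by (intros; now apply sort_map).
  assert (Hl : forall G t A D sigma tau, awf T D -> sub_eq D sigma tau G ->
    aty T G t (Some A) -> aty T D (sub sigma t) (Some (sub sigma A))).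
  { intros G t A D sigma tau HD (H & _) Ht.
    apply annotated_sub with (D := D) (sigma := sigma) in Ht; auto. }
  assert (Hr : forall G t A D sigma tau, awf T D -> sub_eq D sigma tau G ->
    aty T G t (Some A) ->
    (exists s, sort s /\ aeq T D (sub sigma A) (sub tau A) s) ->
    aty T D (sub tau t) (Some (sub sigma A))).
  { intros G t A D sigma tau HD (_ & H & _) Ht (s & Hss & E).
    apply annotated_sub with (D := D) (sigma := tau) in Ht; auto.
    eapply aty_conv'; eauto using aeq_sym'. }
  apply annotated_ind; auto.
  - congruence.
  - intros G A s Hss HA IH D sigma tau HD HR A' E; injection E as <-.
    specialize (IH D _ _ HD HR). rewrite Hs in IH; eauto.
  - intros; now apply aeq_refl', aty_typ.
  - intros G c A d HG _ Hc HA IH D sigma tau HD HR; simpl.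
    destruct (HT _ _ _ Hc) as [HA' _]; rewrite HA'.
    destruct HR as (HR & _).
    apply annotated_sub with (D := D) (sigma := sigma) in HA; auto; simpl in HA.
    rewrite HA' in HA.
    apply aeq_refl; auto. econstructor; eauto.
  - intros G i A HG _ Hi HA IH D sigma tau HD (_ & _ & HR); simpl; auto.
  - intros G A B s Hss HA IHA HB IHB D sigma tau HD HR; simpl.
    rewrite Hs by auto.
    specialize (IHA D _ _ HD HR); simpl in IHA.
    destruct (aeq_valid _ _ _ _ IHA) as (_ & ? & ?).
    specialize (IHB (sub sigma A :: D) _ _ ltac:(constructor; auto)
                  (sub_eq_up _ _ _ _ _ HD HR IHA)).
    rewrite Hs in IHB by auto.
    destruct (aeq_valid _ _ _ _ IHB) as (_ & ? & ?).
    assert (HP : aty T G (Pi A B) s) by (apply aty_pi; auto).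
    apply aeq_pi; auto using aok_sort, aty_pi.
    destruct HR as (_ & HR & _).
    apply annotated_sub with (D := D) (sigma := tau) in HP; auto.
    rewrite Hs in HP; auto.
  - intros G A t B HA IHA HB IHB HP IHP Ht IHt D sigma tau HD HR; simpl.
    specialize (IHA D _ _ HD HR); simpl in IHA.
    destruct (aeq_valid _ _ _ _ IHA) as (_ & ? & ?).
    specialize (IHt (sub sigma A :: D) _ _ ltac:(constructor; auto)
                  (sub_eq_up _ _ _ _ _ HD HR IHA)).
    assert (HL : aty T G (Lam A t) (Some (Pi A B))) by (apply aty_lam; auto).
    pose proof (Hl _ _ _ _ _ _ HD HR HL) as H1.
    pose proof (Hr _ _ _ _ _ _ HD HR HL (IHP _ _ _ HD HR _ eq_refl)) as H2.
    apply aeq_lam; auto; [eapply aty_ok; eauto | eapply aeq_valid; eauto].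
  - intros G f a A B HA IHA HB IHB HBa IHBa Hf IHf Ha IHa D sigma tau HD HR; simpl.
    specialize (IHA D _ _ HD HR); simpl in IHA.
    destruct (aeq_valid _ _ _ _ IHA) as (_ & ? & ?).
    assert (HL : aty T G (App f a) (Some (sub1 B a))) by (eapply aty_app; eauto).
    pose proof (Hl _ _ _ _ _ _ HD HR HL) as H1.
    pose proof (Hr _ _ _ _ _ _ HD HR HL (IHBa _ _ _ HD HR _ eq_refl)) as H2.
    specialize (IHf _ _ _ HD HR). specialize (IHa _ _ _ HD HR).
    simpl in IHf, IHa, H1, H2. rewrite sub_sub1 in *.
    apply aeq_app with (sub sigma A); auto; [eapply aty_ok; eauto|].
    destruct HR as (HR & _).
    apply annotated_sub with (D := sub sigma A :: D) (sigma := up_sub sigma) in HB; auto.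
    { constructor; auto. }
    now apply sub_ok_up.
  - intros G t A A' s Hss HA IHA HA' IHA' Ht IHt E _ D sigma tau HD HR; simpl.
    specialize (IHt _ _ _ HD HR).
    apply annotated_sub with (D := D) (sigma := sigma) in E; auto; [|apply HR].
    rewrite Hs in E by auto. eapply aeq_conv'; eauto.
Qed.

End Metatheory.

(** * Inversion of products and rules with presuppositions reconstructed *)

Lemma aty_pi_inv T G A B C :
  aty T G (Pi A B) C ->
  aty T G A (Some Typ) /\ exists s, sort s /\ aty T (A :: G) B s.
Proof.
  intros H; remember (Pi A B) as P eqn:E; revert A B E.
  induction H; intros A0 B0 E; try discriminate; auto.
  injection E as -> ->; eauto.
Qed.

Lemma aok_pi_inv T G A B :
  aok T G (Some (Pi A B)) -> aty T G A (Some Typ) /\ aok T (A :: G) (Some B).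
Proof.
  intros H; inversion H; subst.
  edestruct aty_pi_inv as (HA & s' & Hs & HB); eauto. split; auto.
  now apply aok_some with s'.
Qed.

Lemma aok_pi T G A B :
  aty T G A (Some Typ) -> aok T (A :: G) (Some B) -> aok T G (Some (Pi A B)).
Proof.
  intros HA HB; inversion HB; subst. apply aok_some with s; auto. now apply aty_pi.
Qed.

Section Admissible.

Variable T : theory.
Hypothesis HT : closed_theory T.

Lemma awf_nth G i A :
  awf T G -> nth_error G i = Some A -> aok T G (Some (ren (fun j => S i + j) A)).
Proof.
  intros HG; revert i A; induction HG as [|G B HG IH HB]; intros [|i] A HA;
    simpl in HA; try discriminate.
  - injection HA as <-. apply aok_some with (Some Typ); auto.
    apply (aty_lift _ HT _ _ _ (Some Typ)); auto.
  - specialize (IH _ _ HA); inversion IH as [|? ? s Hs IH']; subst.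
    replace (ren (fun j => S (S i) + j) A) with (lift (ren (fun j => S i + j) A))
      by (unfold lift; rewrite ren_ren; apply ren_ext; reflexivity).
    apply aok_some with s; auto.
    replace s with (option_map lift s) by now apply sort_map.
    now apply aty_lift.
Qed.

Lemma sub1_sub_ok G A a :
  awf T G -> aty T G a (Some A) ->
  sub_ok T G (fun i => match i with 0 => a | S j => Var j end) (A :: G).
Proof.
  intros HG Ha [|i] B HB; simpl in HB.
  - injection HB as <-. rewrite sub_ren, sub_var; auto.
  - rewrite sub_ren.
    replace (sub _ B) with (ren (fun j => S i + j) B).
    + apply aty_var; auto using awf_nth.
    + rewrite ren_as_sub; apply sub_ext; reflexivity.
Qed.

Lemma aty_sub1 G A a t C :
  aty T G a (Some A) -> aty T (A :: G) t C ->
  aty T G (sub1 t a) (option_map (fun B => sub1 B a) C).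
Proof.
  intros Ha Ht. pose proof (aty_wf _ _ _ _ Ha).
  eapply annotated_sub with (D := G) in Ht; eauto using sub1_sub_ok.
Qed.

Lemma aok_sub1 G A a C :
  aty T G a (Some A) -> aok T (A :: G) C ->
  aok T G (option_map (fun B => sub1 B a) C).
Proof.
  intros Ha Ht. pose proof (aty_wf _ _ _ _ Ha).
  eapply annotated_sub with (D := G) in Ht; eauto using sub1_sub_ok.
Qed.

Lemma aeq_sub1_r G A a a' t C :
  aeq T G a a' (Some A) -> aty T (A :: G) t C ->
  aeq T G (sub1 t a) (sub1 t a') (option_map (fun B => sub1 B a) C).
Proof.
  intros Ha Ht. destruct (aeq_valid _ _ _ _ _ Ha) as (_ & H & H').
  pose proof (aty_wf _ _ _ _ H).
  eapply functionality with (D := G) in Ht; eauto.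
  repeat split; auto using sub1_sub_ok.
  intros [|i] B HB; simpl in HB.
  - injection HB as <-. rewrite sub_ren, sub_var; auto.
  - apply aeq_refl'. now apply (sub1_sub_ok G A a H0 H (S i) B).
Qed.

(** Replacing the type of a variable by an equal one is the identity substitution between the two
    contexts, so context conversion becomes an instance of the substitution lemma. *)
Lemma context_conversion G A A' :
  aeq T G A A' (Some Typ) -> sub_ok T (A' :: G) Var (A :: G).
Proof.
  intros HA i B HB. rewrite sub_var.
  destruct (aeq_valid _ _ _ _ _ HA) as (_ & H & H').
  assert (HG : awf T (A' :: G)) by (constructor; auto; eapply aty_wf; eauto).
  destruct i as [|i]; simpl in HB.
  - injection HB as <-. change (ren _ A) with (lift A).
    apply aty_conv' with (lift A') (Some Typ); auto using aty_var0.
    apply (aeq_lift _ HT _ _ _ _ (Some Typ)); auto using aeq_sym'.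
  - apply aty_var; auto. now apply (awf_nth (A' :: G) (S i)).
Qed.

Lemma aty_context_conv G A A' t C :
  aeq T G A A' (Some Typ) -> aty T (A :: G) t C -> aty T (A' :: G) t C.
Proof.
  intros HA Ht. destruct (aeq_valid _ _ _ _ _ HA) as (_ & H & H').
  eapply annotated_sub with (D := A' :: G) in Ht;
    eauto using context_conversion.
  - rewrite sub_var in Ht. destruct C; simpl in Ht; rewrite ?sub_var in Ht; auto.
  - constructor; auto; eapply aty_wf; eauto.
Qed.

Lemma aeq_pi' G A A' B B' s :
  sort s -> aeq T G A A' (Some Typ) -> aeq T (A :: G) B B' s ->
  aeq T G (Pi A B) (Pi A' B') s.
Proof.
  intros Hs HA HB.
  destruct (aeq_valid _ _ _ _ _ HA) as (_ & ? & ?),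
    (aeq_valid _ _ _ _ _ HB) as (_ & ? & ?).
  apply aeq_pi; auto using aty_pi.
  - apply aok_sort; auto; eapply aty_wf; eauto.
  - apply aty_pi; auto. eapply aty_context_conv; eauto.
Qed.

Lemma aty_lam' G A t B :
  aty T G A (Some Typ) -> aty T (A :: G) t (Some B) ->
  aty T G (Lam A t) (Some (Pi A B)).
Proof.
  intros HA Ht. pose proof (aty_ok _ _ _ _ Ht).
  apply aty_lam; auto using aok_pi.
Qed.

Lemma aeq_lam' G A A' t t' B :
  aeq T G A A' (Some Typ) -> aeq T (A :: G) t t' (Some B) ->
  aeq T G (Lam A t) (Lam A' t') (Some (Pi A B)).
Proof.
  intros HA Ht.
  destruct (aeq_valid _ _ _ _ _ HA) as (_ & ? & ?),
    (aeq_valid _ _ _ _ _ Ht) as (HB & ? & ?).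
  apply aeq_lam; auto using aok_pi, aty_lam'.
  inversion HB as [|? ? s Hs HBs]; subst.
  (* The right abstraction naturally has its own domain [A']; it is typed there after context
     conversion and then moved to the common product. *)
  apply aty_conv' with (Pi A' B) s; auto.
  - apply aty_lam'; auto. eapply aty_context_conv; eauto.
  - apply aeq_sym', aeq_pi'; auto using aeq_refl'.
Qed.

Lemma aty_app' G f a A B :
  aty T G f (Some (Pi A B)) -> aty T G a (Some A) ->
  aty T G (App f a) (Some (sub1 B a)).
Proof.
  intros Hf Ha.
  destruct (aok_pi_inv _ _ _ _ (aty_ok _ _ _ _ Hf)) as (HA & HB).
  eapply aty_app; eauto. eapply (aok_sub1 _ _ _ (Some B)); eauto.
Qed.

Lemma aeq_app' G f f' a a' A B :
  aeq T G f f' (Some (Pi A B)) -> aeq T G a a' (Some A) ->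
  aeq T G (App f a) (App f' a') (Some (sub1 B a)).
Proof.
  intros Hf Ha.
  destruct (aeq_valid _ _ _ _ _ Hf) as (HP & ? & ?),
    (aeq_valid _ _ _ _ _ Ha) as (_ & ? & ?).
  destruct (aok_pi_inv _ _ _ _ HP) as (HA & HB).
  apply aeq_app with A; eauto using aty_app'.
  - eapply (aok_sub1 _ _ _ (Some B)); eauto.
  - inversion HB as [|? ? s Hs HBs]; subst.
    apply aty_conv' with (sub1 B a') s; auto; [eapply aty_app'; eauto|].
    replace s with (option_map (fun C => sub1 C a) s) by now apply sort_map.
    apply aeq_sym'. eapply aeq_sub1_r; eauto.
Qed.

Lemma aeq_beta' G A t B a :
  aty T (A :: G) t (Some B) -> aty T G a (Some A) ->
  aeq T G (App (Lam A t) a) (sub1 t a) (Some (sub1 B a)).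
Proof.
  intros Ht Ha.
  assert (HA : aty T G A (Some Typ)).
  { pose proof (aty_wf _ _ _ _ Ht) as H; now inversion H. }
  pose proof (aty_ok _ _ _ _ Ht).
  apply aeq_beta; auto.
  - eapply (aok_sub1 _ _ _ (Some B)); eauto.
  - eapply aty_app'; eauto using aty_lam'.
  - eapply (aty_sub1 _ _ _ _ (Some B)); eauto.
Qed.

Lemma aeq_eta' G f A B :
  aty T G f (Some (Pi A B)) ->
  aeq T G (Lam A (App (lift f) (Var 0))) f (Some (Pi A B)).
Proof.
  intros Hf. pose proof (aty_ok _ _ _ _ Hf) as HP.
  destruct (aok_pi_inv _ _ _ _ HP) as (HA & HB).
  apply aeq_eta; auto. apply aty_lam'; auto.
  rewrite <- (sub1_up_lift B).
  apply aty_app' with (lift A); auto using aty_var0.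
  apply (aty_lift _ HT _ _ _ (Some (Pi A B))); auto.
Qed.

End Admissible.

(** * Agreement with the typing judgments *)

Scheme wf_ctx_mut := Minimality for wf_ctx Sort Prop
with is_kind_mut := Minimality for is_kind Sort Prop
with has_type_mut := Minimality for has_type Sort Prop
with eq_kind_mut := Minimality for eq_kind Sort Prop
with eq_expr_mut := Minimality for eq_expr Sort Prop.
Combined Scheme typing_ind from
  wf_ctx_mut, is_kind_mut, has_type_mut, eq_kind_mut, eq_expr_mut.

(** Proved on the original judgments, because closedness of the constants must be available before
    derivations can be annotated. *)
Lemma typed_scope T :
  (forall G, wf_ctx T G -> True) /\
  (forall G K, is_kind T G K -> forall sigma,
     (forall i, i < length G -> sigma i = Var i) -> sub sigma K = K) /\
  (forall G t A, has_type T G t A -> forall sigma,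
     (forall i, i < length G -> sigma i = Var i) -> sub sigma t = t) /\
  (forall G K K', eq_kind T G K K' -> True) /\
  (forall G t u A, eq_expr T G t u A -> True).
Proof.
  assert (Hup : forall (G : ctx) A sigma,
    (forall i, i < length G -> sigma i = Var i) ->
    forall i, i < length (A :: G) -> up_sub sigma i = Var i).
  { intros G A sigma H [|i] Hi; simpl in *; auto.
    rewrite H by lia; reflexivity. }
  apply typing_ind; auto; intros; simpl; try (f_equal; solve [eauto]).
  match goal with H : forall i, _ < _ -> _ |- _ => apply H end.
  apply nth_error_Some; congruence.
Qed.

Lemma has_type_closed T t A : has_type T [] t A -> closed t.
Proof. intros H sigma; eapply typed_scope in H; eauto. simpl; lia. Qed.

Lemma is_kind_closed T K : is_kind T [] K -> closed K.
Proof. intros H sigma; eapply typed_scope in H; eauto. simpl; lia. Qed.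

Definition judg (T : theory) (G : ctx) (t : expr) (C : option expr) : Prop :=
  match C with Some A => has_type T G t A | None => is_kind T G t end.

Definition judg_eq (T : theory) (G : ctx) (t u : expr) (C : option expr) : Prop :=
  match C with Some A => eq_expr T G t u A | None => eq_kind T G t u end.

Lemma annotated_sound T :
  (forall G, awf T G -> wf_ctx T G) /\
  (forall G C, aok T G C -> True) /\
  (forall G t C, aty T G t C -> judg T G t C) /\
  (forall G t u C, aeq T G t u C -> judg_eq T G t u C).
Proof.
  apply annotated_ind; auto; simpl; intros;
    repeat match goal with H : sort _ |- _ => destruct H as [-> | ->] end;
    try destruct C; simpl in *; eauto using wf_ctx, is_kind, has_type, eq_kind, eq_expr.
Qed.

(** The form of [wf_theory] used by the inductions: each declaration found by [lookup] is checked
    over the whole theory, not only over the part that precedes it. *)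
Definition valid_theory (T : theory) : Prop :=
  closed_theory T /\
  forall c A d, lookup T c = Some (A, d) ->
    aok T [] (Some A) /\ forall t, d = Some t -> aty T [] t (Some A).

Lemma aty_closed T t C : aty T [] t C -> closed t.
Proof.
  intros H; apply annotated_sound in H.
  destruct C; simpl in H; eauto using has_type_closed, is_kind_closed.
Qed.

Lemma aok_closed T A : aok T [] (Some A) -> closed A.
Proof. inversion 1; eauto using aty_closed. Qed.

Lemma ren_ok_nil D xi : ren_ok D xi [].
Proof. intros [|i] A; discriminate. Qed.

Lemma aok_weaken_nil T G A :
  closed_theory T -> awf T G -> aok T [] (Some A) -> aok T G (Some A).
Proof.
  intros HT HG HA. rewrite <- (closed_ren A (fun i => i)) by eauto using aok_closed.
  eapply annotated_ren with (C := Some A) in HA; eauto using ren_ok_nil.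
Qed.

Lemma aeq_weaken_nil T G t u A :
  closed_theory T -> awf T G -> aeq T [] t u (Some A) -> aeq T G t u (Some A).
Proof.
  intros HT HG H. destruct (aeq_valid _ _ _ _ _ H) as (HA & Ht & Hu).
  rewrite <- (closed_ren A (fun i => i)) by eauto using aok_closed.
  rewrite <- (closed_ren t (fun i => i)) by eauto using aty_closed.
  rewrite <- (closed_ren u (fun i => i)) by eauto using aty_closed.
  eapply annotated_ren with (C := Some A) in H; eauto using ren_ok_nil.
Qed.

Lemma aty_weaken_nil T G t A :
  closed_theory T -> awf T G -> aty T [] t (Some A) -> aty T G t (Some A).
Proof.
  intros HT HG H. eapply aeq_valid, aeq_weaken_nil; eauto using aeq_refl'.
Qed.

(** An annotated premise already contains the validity of its classifier, and the primed rules
    rebuild all remaining presuppositions from it. *)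
Lemma annotated_complete T : valid_theory T ->
  (forall G, wf_ctx T G -> awf T G) /\
  (forall G K, is_kind T G K -> aty T G K None) /\
  (forall G t A, has_type T G t A -> aty T G t (Some A)) /\
  (forall G K K', eq_kind T G K K' -> aeq T G K K' None) /\
  (forall G t u A, eq_expr T G t u A -> aeq T G t u (Some A)).
Proof.
  intros [HT HV].
  apply typing_ind; intros.
  - constructor.
  - constructor; auto.
  - now constructor.
  - apply aty_pi; auto.
  - destruct (HV _ _ _ H1) as [HA _].
    apply aty_const with d; auto. apply aok_weaken_nil; auto.
  - apply aty_var; auto using awf_nth.
  - apply aty_pi; auto.
  - apply aty_lam'; auto.
  - eapply aty_app'; eauto.
  - apply aty_conv' with A (Some Typ); auto.
  - apply aty_conv' with K None; auto.
  - now apply aeq_refl'.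
  - now apply aeq_sym'.
  - eapply aeq_trans'; eauto.
  - apply aeq_pi'; auto.
  - now apply aeq_refl'.
  - now apply aeq_sym'.
  - eapply aeq_trans'; eauto.
  - apply aeq_pi'; auto.
  - apply aeq_lam'; auto.
  - eapply aeq_app'; eauto.
  - apply aeq_beta'; auto.
  - apply aeq_eta'; auto.
  - destruct (HV _ _ _ H1) as [HA Ht]. specialize (Ht _ eq_refl).
    assert (aok T G (Some A)) by (apply aok_weaken_nil; auto).
    apply aeq_delta; auto.
    + now apply aty_const with (Some t).
    + now apply aty_weaken_nil.
  - apply aeq_conv' with A (Some Typ); auto.
  - apply aeq_conv' with K None; auto.
Qed.

Lemma annotated_theory_mono T T' :
  (forall c e, lookup T c = Some e -> lookup T' c = Some e) ->
  (forall G, awf T G -> awf T' G) /\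
  (forall G C, aok T G C -> aok T' G C) /\
  (forall G t C, aty T G t C -> aty T' G t C) /\
  (forall G t u C, aeq T G t u C -> aeq T' G t u C).
Proof.
  intros HI; apply annotated_ind; intros.
  - constructor.
  - now constructor.
  - now constructor.
  - now apply aok_some with s.
  - now constructor.
  - apply aty_const with d; auto.
  - now apply aty_var.
  - now apply aty_pi.
  - now apply aty_lam.
  - now apply aty_app with A.
  - now apply aty_conv with A s.
  - now apply aeq_refl.
  - now apply aeq_sym.
  - now apply aeq_trans with u.
  - now apply aeq_pi.
  - now apply aeq_lam.
  - now apply aeq_app with A.
  - now apply aeq_beta with (A := A).
  - now apply aeq_eta.
  - apply aeq_delta; auto.
  - now apply aeq_conv with A s.
Qed.

(** Annotating a derivation presupposes a valid theory. There is no circle: a new declaration is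
    typed over the preceding theory, which is valid by induction, and its annotated derivation is
    then carried over by monotonicity. *)
Lemma wf_theory_valid T : wf_theory T -> valid_theory T.
Proof.
  induction 1 as [|T c A d HW [HT HV] Hc HA Hd|T T' HW [HT HV] HW' [HT' HV'] HI].
  - split; intros c A d H; discriminate.
  - assert (HM : forall c' e, lookup T c' = Some e ->
      lookup (TConst T c A d) c' = Some e).
    { intros c' e H; simpl. destruct (Nat.eqb_spec c' c); congruence. }
    destruct (annotated_complete T (conj HT HV)) as (_ & Hk & Ht & _).
    split; intros c' A' d' H; simpl in H; destruct (Nat.eqb_spec c' c).
    + injection H as <- <-; split.
      * destruct HA; eauto using has_type_closed, is_kind_closed.
      * intros; eapply has_type_closed; eauto.
    + eauto.
    + injection H as <- <-; split.
      * destruct HA as [HA|HA]; [apply aok_some with (Some Typ)|apply aok_some with None];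
          auto; apply (annotated_theory_mono T); auto.
      * intros; apply (annotated_theory_mono T); auto.
    + destruct (HV _ _ _ H); split; [|intros]; apply (annotated_theory_mono T); auto.
  - assert (HM : forall c e, lookup T c = Some e -> lookup (TIncl T T') c = Some e).
    { intros c e H; simpl. now rewrite H. }
    (* If both sides declare [c], [lookup] returns the left entry; the compatibility premise of
       [wft_incl] identifies it with the right one. *)
    assert (HM' : forall c e, lookup T' c = Some e -> lookup (TIncl T T') c = Some e).
    { intros c e H; simpl. destruct (lookup T c) eqn:E; auto. f_equal; eauto. }
    split; intros c A d H; simpl in H; destruct (lookup T c) eqn:E.
    + injection H as ->; eauto.
    + eauto.
    + injection H as ->.
      destruct (HV _ _ _ E); split; [|intros]; apply (annotated_theory_mono T); auto.
    + destruct (HV' _ _ _ H); split; [|intros]; apply (annotated_theory_mono T'); auto.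
Qed.

(** * Levels and definedness *)

Fixpoint kindly (e : expr) : bool :=
  match e with Typ => true | Pi _ K => kindly K | _ => false end.

(** Recognizes types and type families by a head constant whose declared classifier is a kind. A
    variable is rejected because contexts only declare variables of types. *)
Fixpoint family (T : theory) (e : expr) : bool :=
  match e with
  | Const c => match lookup T c with Some (A, _) => kindly A | None => false end
  | Pi _ B | Lam _ B => family T B
  | App f _ => family T f
  | Var _ | Typ => false
  end.

Definition classifier (T : theory) (A : expr) : Prop :=
  kindly A = true \/ kindly A = false /\ family T A = true.

Lemma family_not_kindly T e : family T e = true -> kindly e = false.
Proof. induction e; simpl; auto; discriminate. Qed.

Lemma kindly_sub e sigma : kindly e = true -> kindly (sub sigma e) = true.
Proof. revert sigma; induction e; simpl; intros; auto; discriminate. Qed.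

Lemma family_sub T e sigma : family T e = true -> family T (sub sigma e) = true.
Proof. revert sigma; induction e; simpl; intros; auto; discriminate. Qed.

(** In general a substitution could turn a variable at the end of a product into [Typ]. A classifier
    that is not a kind is a family, and this property survives substitution and excludes being a
    kind. *)
Lemma classifier_sub T A sigma :
  classifier T A -> kindly (sub sigma A) = kindly A.
Proof.
  intros [H|[H H']]; rewrite H.
  - now apply kindly_sub.
  - eapply family_not_kindly, family_sub; eauto.
Qed.

Lemma kindly_ren e xi : kindly (ren xi e) = kindly e.
Proof. revert xi; induction e; simpl; auto. Qed.

Lemma family_ren T e xi : family T (ren xi e) = family T e.
Proof. revert xi; induction e; simpl; auto. Qed.

(** The component for contexts serves the variable rule: declared types are families, so no variable
    is classified by a kind. *)
Lemma level_of T :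
  (forall G, awf T G -> forall i A, nth_error G i = Some A -> family T A = true) /\
  (forall G C, aok T G C -> forall A, C = Some A -> classifier T A) /\
  (forall G t C, aty T G t C ->
     match C with
     | None => kindly t = true
     | Some A => if kindly A then family T t = true else family T A = true
     end) /\
  (forall G t u C, aeq T G t u C -> True).
Proof.
  assert (Hc : forall A, family T A = true -> classifier T A)
    by (intros A H; right; eauto using family_not_kindly).
  apply annotated_ind; auto; simpl.
  - intros [|i]; discriminate.
  - intros G A _ HG _ HA [|i] B HB; simpl in HB; eauto. now injection HB as <-.
  - discriminate.
  - intros G A s [-> | ->] _ H B E; injection E as <-; simpl in H; auto. now left.
  - intros G c A d _ _ -> _ H. destruct (H A eq_refl) as [->|[-> ?]]; auto.
  - intros G i A _ HG Hi _ _. specialize (HG _ _ Hi).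
    now rewrite kindly_ren, family_ren, (family_not_kindly _ _ HG).
  - intros G f a A B _ _ _ HB _ _ _ IHf _ _. specialize (HB _ eq_refl).
    unfold sub1; rewrite (classifier_sub _ _ _ HB).
    destruct (kindly B); auto. now apply family_sub.
  - intros G t A A' s [-> | ->] _ HA _ HA' _ IH _ _; simpl in *.
    + rewrite HA in IH; now rewrite HA'.
    + now rewrite (family_not_kindly _ _ HA').
Qed.

Lemma aok_classifier T G A : aok T G (Some A) -> classifier T A.
Proof. intros H; eapply level_of; eauto. Qed.

Lemma aty_kind T G K : aty T G K None -> kindly K = true.
Proof. intros H; apply level_of in H; auto. Qed.

Lemma aty_type T G A : aty T G A (Some Typ) -> family T A = true.
Proof. intros H; apply level_of in H; auto. Qed.

Lemma aty_family T G t A :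
  aty T G t (Some A) -> kindly A = true -> family T t = true.
Proof. intros H HA; apply level_of in H; simpl in H; now rewrite HA in H. Qed.

Lemma aty_sort_kindly T G A A' s :
  sort s -> aty T G A s -> aty T G A' s -> kindly A = kindly A'.
Proof.
  intros [-> | ->] H H'.
  - now rewrite (aty_kind _ _ _ H), (aty_kind _ _ _ H').
  - now rewrite (family_not_kindly _ _ (aty_type _ _ _ H)),
      (family_not_kindly _ _ (aty_type _ _ _ H')).
Qed.

(* The head of a kind or type family is never a variable, so whether [rbar] is
   defined on it does not depend on the environment.  This is what makes
   definedness stable under substitution and conversion. *)
Fixpoint head_defined (r : cname -> option expr) (e : expr) : bool :=
  match e with
  | Const c => defined (r c)
  | Var _ => false
  | Typ => true
  | Pi _ B | Lam _ B => head_defined r B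
  | App f _ => head_defined r f
  end.

Lemma head_defined_ren r e xi : head_defined r (ren xi e) = head_defined r e.
Proof. revert xi; induction e; simpl; auto. Qed.

Lemma head_defined_kindly r e : kindly e = true -> head_defined r e = true.
Proof. induction e; simpl; auto; discriminate. Qed.

Lemma head_defined_sub T r e sigma :
  kindly e = true \/ family T e = true ->
  head_defined r (sub sigma e) = head_defined r e.
Proof.
  revert sigma; induction e; simpl; intros sigma [H|H]; auto; discriminate.
Qed.

Lemma defined_option_map {A} (f : A -> expr) o :
  defined (option_map f o) = match o with Some _ => true | None => false end.
Proof. now destruct o. Qed.

Lemma defined_rbar_pi m r E A B :
  defined (rbar m r E (Pi A B))
  = defined (rbar m r (ext (defined (rbar m r (shift E) A)) (shift E)) B).
Proof. simpl; now rewrite defined_option_map. Qed.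

Lemma defined_rbar_lam m r E A t :
  defined (rbar m r E (Lam A t))
  = defined (rbar m r (ext (defined (rbar m r E A)) E) t).
Proof. simpl; now rewrite defined_option_map. Qed.

Lemma defined_rbar_app m r E f a :
  defined (rbar m r E (App f a)) = defined (rbar m r E f).
Proof. simpl; destruct (rbar m r E f), (rbar m r E a); auto. Qed.

Lemma defined_rbar T m r E e :
  kindly e = true \/ family T e = true ->
  defined (rbar m r E e) = head_defined r e.
Proof.
  revert E; induction e; intros E H; rewrite ?defined_rbar_pi, ?defined_rbar_lam,
    ?defined_rbar_app; simpl in *; destruct H; auto; discriminate.
Qed.

Lemma defined_iff (o : option expr) : defined o = true <-> o <> None.
Proof. destruct o; simpl; split; congruence. Qed.

Lemma defined_some (o : option expr) : defined o = true -> exists x, o = Some x.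
Proof. destruct o; simpl; [eauto|discriminate]. Qed.

(** * Definedness on equal families and on terms versus their classifiers *)

Section Definedness.

Variables (T U : theory) (m : cname -> expr) (r : cname -> option expr).
Hypothesis HV : valid_theory T.
Hypothesis HR : partial_logrel T U m r.

(** In a beta step the contracted body is itself a family, so its head is a constant that
    substitution cannot touch. The delta case is what requires [r] and the image of the definiens to
    be defined together. *)
Lemma head_defined_eq :
  (forall G, awf T G -> True) /\
  (forall G C, aok T G C -> True) /\
  (forall G t C, aty T G t C -> True) /\
  (forall G t u C, aeq T G t u C -> forall A, C = Some A -> kindly A = true ->
     head_defined r t = head_defined r u).
Proof.
  apply annotated_ind; auto; simpl.
  - intros. symmetry; eauto.
  - intros; etransitivity; eauto.
  - intros. match goal with E : Some (Pi _ _) = Some _ |- _ => injection E as <- end.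
    eauto.
  - intros G f f' a a' A B _ _ _ _ _ _ _ _ HB _ _ IH _ _ C E HC.
    injection E as <-. unfold sub1 in HC.
    rewrite (classifier_sub T) in HC; eauto using aok_classifier.
  - intros G A t B a _ _ _ _ _ _ _ _ HB _ Ht _ _ _ C E HC.
    injection E as <-. unfold sub1 in HC.
    rewrite (classifier_sub T) in HC; eauto using aok_classifier.
    symmetry; apply head_defined_sub with T. right; eapply aty_family; eauto.
  - intros; apply head_defined_ren.
  - intros G c A t _ _ _ _ _ _ Ht _ Hc B E HB; injection E as <-.
    destruct (HR _ _ _ Hc) as [_ H]. destruct (H _ eq_refl) as [Hd _].
    rewrite <- !defined_iff in Hd.
    rewrite (defined_rbar T) in Hd by (right; eapply aty_family; eauto).
    apply eq_true_iff_eq; auto.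
  - intros G t u A A' s Hs HA _ HA' _ _ _ _ _ _ IH _ _ B E HB.
    injection E as <-. apply IH with A; auto.
    erewrite aty_sort_kindly; eauto.
Qed.

Lemma head_defined_conv G A A' s :
  sort s -> aeq T G A A' s -> head_defined r A = head_defined r A'.
Proof.
  intros [-> | ->] H.
  - destruct (aeq_valid _ _ _ _ _ H) as (_ & H1 & H2).
    rewrite !head_defined_kindly; eauto using aty_kind.
  - eapply head_defined_eq in H; eauto.
Qed.

Lemma defined_type E A G : aty T G A (Some Typ) ->
  defined (rbar m r E A) = head_defined r A.
Proof. intros; eapply defined_rbar; right; eapply aty_type; eauto. Qed.

Lemma star_defined G i A :
  awf T G -> nth_error G i = Some A ->
  match star (renv_of m r G) i with Some _ => true | None => false end
  = head_defined r A.
Proof.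
  intros HG; revert i; induction HG as [|G B HG IH HB]; intros [|i] Hi;
    simpl in Hi; try discriminate.
  - injection Hi as ->; simpl.
    rewrite <- (defined_type (renv_of m r G) A G HB).
    destruct (rbar m r (renv_of m r G) A); auto.
  - rewrite <- (IH _ Hi); simpl. destruct (defined _); simpl;
      destruct (star (renv_of m r G) i); auto.
Qed.

(** Abstraction and application pass the question to the body and to the function. A variable has
    its companion exactly when its type has an image, by construction of the environment. Constants
    decide the rest: one direction is part of being a logical relation, and only the other uses
    totality. *)
Lemma defined_term_classifier :
  (forall G, awf T G -> True) /\
  (forall G C, aok T G C -> True) /\
  (forall G t C, aty T G t C -> forall A, C = Some A -> kindly A = false ->
     (defined (rbar m r (renv_of m r G) t) = true -> head_defined r A = true) /\
     (term_total T m r -> head_defined r A = true ->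
      defined (rbar m r (renv_of m r G) t) = true)) /\
  (forall G t u C, aeq T G t u C -> True).
Proof.
  apply annotated_ind; auto; try discriminate.
  - intros G c A d HG _ Hc HA _ B E HB; injection E as <-.
    destruct (proj2 HV _ _ _ Hc) as [HA' _].
    assert (HF : family T A = true)
      by (apply aok_classifier in HA as [|[_ ?]]; congruence).
    split.
    + intros Hd; apply defined_some in Hd as [rc Hrc].
      destruct (HR _ _ _ Hc) as [H _]. destruct (H _ Hrc) as (rA & HrA & _).
      rewrite <- (defined_rbar T m r renv0), HrA by auto; reflexivity.
    + intros Htt Hd. apply defined_iff. eapply Htt; eauto.
      * inversion HA' as [|? ? s Hs HAs]; subst. destruct Hs as [-> | ->].
        { apply aty_kind in HAs; congruence. }
        now apply annotated_sound in HAs.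
      * apply defined_iff. rewrite (defined_rbar T); auto.
  - intros G i A HG _ Hi HA _ B E HB; injection E as <-.
    rewrite head_defined_ren, <- (star_defined _ _ _ HG Hi); simpl.
    rewrite defined_option_map. tauto.
  - intros G A B s [-> | ->] _ _ _ _ C E HC; try discriminate. now injection E as <-.
  - intros G A t B HA _ HB _ HP _ Ht IH C E HC; injection E as <-.
    rewrite defined_rbar_lam. apply (IH _ eq_refl HC).
  - intros G f a A B HA _ HB _ HBa _ Hf IH _ _ C E HC; injection E as <-.
    rewrite defined_rbar_app. unfold sub1 in *.
    rewrite (classifier_sub T) in HC by eauto using aok_classifier.
    rewrite (head_defined_sub T).
    + apply (IH _ eq_refl HC).
    + apply aok_classifier in HB as [|[_ ?]]; auto.
  - intros G t A A' s Hs HA _ HA' _ Ht IH E _ C EC HC; injection EC as <-.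
    rewrite <- (head_defined_conv _ _ _ _ Hs E). apply IH; auto.
    erewrite aty_sort_kindly; eauto.
Qed.

Lemma defined_classifier G t A E :
  aty T G t (Some A) -> defined (rbar m r (renv_of m r G) t) = true ->
  defined (rbar m r E A) = true.
Proof.
  intros H Hd. assert (HA := aok_classifier _ _ _ (aty_ok _ _ _ _ H)).
  destruct HA as [HA|[HA HF]].
  - rewrite (defined_rbar T); auto using head_defined_kindly.
  - rewrite (defined_rbar T); auto. eapply defined_term_classifier in H; eauto.
    now apply H.
Qed.

(** The head constant of a family is declared with a kind, and [rbar] is defined on every kind, so
    [const_total] forces [r] to be defined there. *)
Lemma const_total_defined :
  const_total T m r -> forall e E, family T e = true -> defined (rbar m r E e) = true.
Proof.
  intros Hct e E He. rewrite (defined_rbar T) by auto.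
  clear E; induction e; simpl in *; auto; try discriminate.
  destruct (lookup T c) as [[A d]|] eqn:Hc; try discriminate.
  apply defined_iff; eapply Hct; eauto. apply defined_iff.
  rewrite (defined_rbar T); auto using head_defined_kindly.
Qed.

End Definedness.

(** Both translations copy the values of constants under binders without lifting them. *)
Definition closed_values (m : cname -> expr) (r : cname -> option expr) : Prop :=
  (forall c, closed (m c)) /\ (forall c t, r c = Some t -> closed t).

(** * Target binders *)

(* The flag [b] tells whether a source variable [x] has a companion [x^*]. *)
Definition wk (b : bool) (i : nat) : nat := if b then S (S i) else S i.
Definition up_ren_if (b : bool) (xi : nat -> nat) : nat -> nat :=
  if b then up_ren (up_ren xi) else up_ren xi.
Definition up_sub_if (b : bool) (sigma : nat -> expr) : nat -> expr :=
  if b then up_sub (up_sub sigma) else up_sub sigma.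
Definition obj_var (b : bool) : expr := Var (if b then 1 else 0).

Lemma option_map_map {A B C} (f : A -> B) (g : B -> C) o :
  option_map g (option_map f o) = option_map (fun x => g (f x)) o.
Proof. now destruct o. Qed.

Lemma ren_bind Q xi A ra e :
  (forall A B, ren xi (Q A B) = Q (ren xi A) (ren (up_ren xi) B)) ->
  (forall A B, ren (up_ren xi) (Q A B) = Q (ren (up_ren xi) A) (ren (up_ren (up_ren xi)) B)) ->
  ren xi (bind Q A ra e)
  = bind Q (ren xi A) (option_map (ren xi) ra) (ren (up_ren_if (defined ra) xi) e).
Proof.
  intros H1 H2; destruct ra; simpl; rewrite H1, ?H2; simpl; now rewrite ?ren_lift.
Qed.

Lemma sub_bind Q sigma A ra e :
  (forall A B sigma, sub sigma (Q A B) = Q (sub sigma A) (sub (up_sub sigma) B)) ->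
  sub sigma (bind Q A ra e)
  = bind Q (sub sigma A) (option_map (sub sigma) ra) (sub (up_sub_if (defined ra) sigma) e).
Proof.
  intros H; destruct ra; simpl; rewrite !H; simpl; now rewrite ?sub_lift.
Qed.

(** * Commutation of both translations with renaming and substitution *)

Section Syntax.

Variables (m : cname -> expr) (r : cname -> option expr).
Hypothesis HC : closed_values m r.

Lemma mbar_ren xi e : mbar m (ren xi e) = ren xi (mbar m e).
Proof.
  revert xi; induction e; intros xi; simpl; f_equal; auto.
  symmetry; apply closed_ren, HC.
Qed.

Lemma mbar_sub sigma e : mbar m (sub sigma e) = sub (fun i => mbar m (sigma i)) (mbar m e).
Proof.
  revert sigma; induction e; intros sigma; simpl; f_equal; auto.
  - symmetry; apply HC.
  - rewrite IHe2; apply sub_ext; intros [|i]; simpl; auto. apply mbar_ren.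
  - rewrite IHe2; apply sub_ext; intros [|i]; simpl; auto. apply mbar_ren.
Qed.

Lemma mbar_sub1 e a : mbar m (sub1 e a) = sub1 (mbar m e) (mbar m a).
Proof. unfold sub1; rewrite mbar_sub; apply sub_ext; intros [|i]; auto. Qed.

(** Here [xi] renames source variables, and [zeta] is the induced renaming of target variables,
    covering objects and companions alike. *)
Definition env_ren (xi zeta : nat -> nat) (E E' : renv) : Prop :=
  forall i, obj E' (xi i) = zeta (obj E i) /\
    star E' (xi i) = option_map zeta (star E i).

Lemma env_ren_ext b xi zeta E E' :
  env_ren xi zeta E E' ->
  env_ren (up_ren xi) (up_ren_if b zeta) (ext b E) (ext b E').
Proof.
  intros H [|i]; destruct b; simpl; auto; destruct (H i) as [-> ->]; auto;
    rewrite !option_map_map; auto.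
Qed.

Lemma env_ren_shift xi zeta E E' :
  env_ren xi zeta E E' -> env_ren xi (up_ren zeta) (shift E) (shift E').
Proof.
  intros H i; simpl; destruct (H i) as [-> ->]; rewrite !option_map_map; auto.
Qed.

Lemma env_ren_to_shift E : env_ren (fun i => i) S E (shift E).
Proof. intros i; simpl; auto. Qed.

(** In the product clause the extra binder [f] lies outside [x] and its companion, so inserting it
    is a weakening below these one or two variables. *)
Lemma env_ren_ext_shift b E :
  env_ren (fun i => i) (up_ren_if b S) (ext b E) (ext b (shift E)).
Proof.
  intros i; pose proof (env_ren_ext b _ _ _ _ (env_ren_to_shift E) i) as H.
  destruct i; exact H.
Qed.

Lemma env_ren_wk b E : env_ren S (wk b) E (ext b E).
Proof. intros i; destruct b; simpl; auto. Qed.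

Lemma ren_id e : ren (fun i => i) e = e.
Proof. rewrite ren_as_sub; apply sub_var. Qed.

Lemma mor_ren xi zeta E E' e :
  env_ren xi zeta E E' -> mor m E' (ren xi e) = ren zeta (mor m E e).
Proof.
  intros H; unfold mor; rewrite mbar_ren, !ren_ren; apply ren_ext; intros; apply H.
Qed.

Lemma mor_shift E e : mor m (shift E) e = lift (mor m E e).
Proof. rewrite <- (mor_ren _ _ _ _ _ (env_ren_to_shift E)); now rewrite ren_id. Qed.

Lemma mor_wk b E e : mor m (ext b E) (lift e) = ren (wk b) (mor m E e).
Proof. apply mor_ren, env_ren_wk. Qed.

Lemma rbar_ren xi zeta E E' e :
  env_ren xi zeta E E' -> rbar m r E' (ren xi e) = option_map (ren zeta) (rbar m r E e).
Proof.
  revert xi zeta E E'; induction e; intros xi zeta E E' H.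
  - simpl; destruct (r c) eqn:Hc; simpl; auto. f_equal.
    symmetry; apply closed_ren. destruct HC; eauto.
  - simpl; destruct (H i) as [_ ->]; now rewrite !option_map_map.
  - reflexivity.
  - cbn [rbar ren].
    rewrite (IHe1 _ _ _ _ (env_ren_shift _ _ _ _ H)), defined_option_map.
    set (ra := rbar m r (shift E) e1).
    change (match ra with Some _ => true | None => false end) with (defined ra).
    rewrite (IHe2 _ _ _ _ (env_ren_ext (defined ra) _ _ _ _ (env_ren_shift _ _ _ _ H))).
    rewrite !option_map_map; destruct (rbar _ _ _ e2); simpl; auto. f_equal. f_equal.
    + unfold mor; simpl. f_equal; rewrite mbar_ren, !ren_ren; apply ren_ext.
      * intros; apply H.
      * intros [|j]; simpl; auto; f_equal; apply H.
    + rewrite ren_bind by auto.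
      rewrite (mor_ren _ _ _ _ _ (env_ren_shift _ _ _ _ H)).
      destruct ra; reflexivity.
  - cbn [rbar ren].
    rewrite (IHe1 _ _ _ _ H), defined_option_map.
    set (ra := rbar m r E e1).
    change (match ra with Some _ => true | None => false end) with (defined ra).
    rewrite (IHe2 _ _ _ _ (env_ren_ext (defined ra) _ _ _ _ H)).
    rewrite !option_map_map; destruct (rbar _ _ _ e2); simpl; auto. f_equal.
    rewrite ren_bind by auto. now rewrite (mor_ren _ _ _ _ _ H).
  - cbn [rbar ren]. rewrite (IHe1 _ _ _ _ H), (IHe2 _ _ _ _ H), (mor_ren _ _ _ _ _ H).
    destruct (rbar m r E e1), (rbar m r E e2); auto.
Qed.

Lemma rbar_shift E e : rbar m r (shift E) e = option_map lift (rbar m r E e).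
Proof.
  rewrite <- (ren_id e) at 1. apply rbar_ren, env_ren_to_shift.
Qed.

Lemma rbar_wk b E e :
  rbar m r (ext b E) (lift e) = option_map (ren (wk b)) (rbar m r E e).
Proof. apply rbar_ren, env_ren_wk. Qed.

(** The second equation also compares definedness: [sigma i] must have an image exactly when
    variable [i] has a companion for which to substitute it. *)
Definition env_sub (sigma tau : nat -> expr) (E E' : renv) : Prop :=
  forall i, mor m E' (sigma i) = tau (obj E i) /\
    rbar m r E' (sigma i) = option_map tau (star E i).

Lemma env_sub_ext b sigma tau E E' :
  env_sub sigma tau E E' ->
  env_sub (up_sub sigma) (up_sub_if b tau) (ext b E) (ext b E').
Proof.
  intros H [|i].
  - destruct b; simpl; auto.
  - simpl; rewrite mor_wk, rbar_wk; destruct (H i) as [-> ->].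
    destruct b; simpl; rewrite !option_map_map; simpl; split; auto;
      unfold lift; rewrite ?ren_ren; auto.
    destruct (star E i); simpl; now rewrite ?ren_ren.
Qed.

Lemma env_sub_shift sigma tau E E' :
  env_sub sigma tau E E' -> env_sub sigma (up_sub tau) (shift E) (shift E').
Proof.
  intros H i; simpl; rewrite mor_shift, rbar_shift; destruct (H i) as [-> ->].
  now rewrite !option_map_map.
Qed.

Lemma mor_sub sigma tau E E' e :
  env_sub sigma tau E E' -> mor m E' (sub sigma e) = sub tau (mor m E e).
Proof.
  intros H; unfold mor; rewrite mbar_sub, ren_sub, sub_ren; apply sub_ext.
  intros i; apply H.
Qed.

Lemma mor_pi E A B : mor m E (Pi A B) = Pi (mor m E A) (mor m (ext false E) B).
Proof. unfold mor; simpl; f_equal; apply ren_ext; intros [|i]; auto. Qed.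

Lemma mor_lam E A t : mor m E (Lam A t) = Lam (mor m E A) (mor m (ext false E) t).
Proof. unfold mor; simpl; f_equal; apply ren_ext; intros [|i]; auto. Qed.

Lemma rbar_sub sigma tau E E' e :
  env_sub sigma tau E E' -> rbar m r E' (sub sigma e) = option_map (sub tau) (rbar m r E e).
Proof.
  revert sigma tau E E'; induction e; intros sigma tau E E' H.
  - simpl; destruct (r c) eqn:Hc; simpl; auto. f_equal.
    symmetry; destruct HC as [_ Hr]; eapply Hr; eauto.
  - simpl; destruct (H i) as [_ ->]; now rewrite !option_map_map.
  - reflexivity.
  - pose proof (mor_sub _ _ _ _ (Pi e1 e2) H) as HP. simpl sub in HP.
    cbn [rbar sub]. rewrite HP.
    rewrite (IHe1 _ _ _ _ (env_sub_shift _ _ _ _ H)), defined_option_map.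
    set (ra := rbar m r (shift E) e1).
    change (match ra with Some _ => true | None => false end) with (defined ra).
    rewrite (IHe2 _ _ _ _ (env_sub_ext (defined ra) _ _ _ _ (env_sub_shift _ _ _ _ H))).
    rewrite !option_map_map; destruct (rbar _ _ _ e2); simpl; auto. f_equal. f_equal.
    rewrite sub_bind by auto.
    rewrite (mor_sub _ _ _ _ _ (env_sub_shift _ _ _ _ H)).
    destruct ra; reflexivity.
  - cbn [rbar sub].
    rewrite (IHe1 _ _ _ _ H), defined_option_map.
    set (ra := rbar m r E e1).
    change (match ra with Some _ => true | None => false end) with (defined ra).
    rewrite (IHe2 _ _ _ _ (env_sub_ext (defined ra) _ _ _ _ H)).
    rewrite !option_map_map; destruct (rbar _ _ _ e2); simpl; auto. f_equal.
    rewrite sub_bind by auto. now rewrite (mor_sub _ _ _ _ _ H).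
  - cbn [rbar sub]. rewrite (IHe1 _ _ _ _ H), (IHe2 _ _ _ _ H), (mor_sub _ _ _ _ _ H).
    destruct (rbar m r E e1), (rbar m r E e2); auto.
Qed.

(* Substitutes [s] for the object variable and, if [b], [s'] for its companion. *)
Definition inst (b : bool) (s s' : expr) (i : nat) : expr :=
  if b then match i with 0 => s' | 1 => s | S (S j) => Var j end
  else match i with 0 => s | S j => Var j end.

(* The default value is immaterial; [Typ] is chosen to be closed. *)
Definition get (o : option expr) : expr := match o with Some e => e | None => Typ end.
Definition rval (E : renv) (e : expr) : expr := get (rbar m r E e).

Lemma tr_some E e t : rbar m r E e = Some t -> rval E e = t.
Proof. unfold rval; now intros ->. Qed.

Lemma tr_eq E e : defined (rbar m r E e) = true -> rbar m r E e = Some (rval E e).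
Proof. unfold rval; destruct (rbar m r E e); [auto|discriminate]. Qed.

Lemma tr_ren xi zeta E E' e :
  env_ren xi zeta E E' -> rval E' (ren xi e) = ren zeta (rval E e).
Proof.
  intros H; unfold rval; rewrite (rbar_ren _ _ _ _ _ H); now destruct (rbar m r E e).
Qed.

Lemma tr_sub sigma tau E E' e :
  env_sub sigma tau E E' -> rval E' (sub sigma e) = sub tau (rval E e).
Proof.
  intros H; unfold rval; rewrite (rbar_sub _ _ _ _ _ H); now destruct (rbar m r E e).
Qed.

(** The binder is laid out according to whether the argument has an image. Translated contexts use
    the type of the variable instead; [defined_arg] later reconciles the two. *)
Lemma env_sub1 E a :
  env_sub (fun i => match i with 0 => a | S j => Var j end)
    (inst (defined (rbar m r E a)) (mor m E a) (rval E a))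
    (ext (defined (rbar m r E a)) E) E.
Proof.
  unfold rval; intros [|i]; destruct (rbar m r E a) eqn:Ha; simpl; auto;
    rewrite ?option_map_map; auto.
Qed.

(** * Relations at a classifier *)

(** Computes directly the kind to which [rbar K] applied to [f] reduces; [krel_red] makes the
    connection. The last branch is a default outside kinds. *)
Fixpoint krel_of (E : renv) (K f : expr) : expr :=
  match K with
  | Typ => Pi f Typ
  | Pi A K' =>
      let ra := rbar m r E A in
      let b := defined ra in
      bind Pi (mor m E A) ra
        (krel_of (ext b E) K' (App (ren (wk b) f) (obj_var b)))
  | _ => Typ
  end.

(* The classifier of [rbar t] for [t : A] and [f = mor t]: [rbar A] applied to
   [f], in reduced form if [A] is a kind. *)
Definition rel_of (E : renv) (A f : expr) : expr :=
  if kindly A then krel_of E A f else App (rval E A) f.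

Lemma krel_ren xi zeta E E' K f :
  env_ren xi zeta E E' -> krel_of E' (ren xi K) (ren zeta f) = ren zeta (krel_of E K f).
Proof.
  revert xi zeta E E' f; induction K; intros xi zeta E E' f H; simpl; auto.
  rewrite ren_bind by auto.
  rewrite (rbar_ren _ _ _ _ _ H), defined_option_map, (mor_ren _ _ _ _ _ H).
  set (ra := rbar m r E K1).
  change (match ra with Some _ => true | None => false end) with (defined ra).
  f_equal. rewrite <- (IHK2 _ _ _ _ _ (env_ren_ext (defined ra) _ _ _ _ H)).
  f_equal. simpl; f_equal.
  - rewrite !ren_ren; apply ren_ext; intros; now destruct (defined ra).
  - now destruct (defined ra).
Qed.

Lemma krel_sub sigma tau E E' K f :
  kindly K = true ->
  env_sub sigma tau E E' -> krel_of E' (sub sigma K) (sub tau f) = sub tau (krel_of E K f).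
Proof.
  intros HK. revert sigma tau E E' f HK;
    induction K; intros sigma tau E E' f HK H; simpl in *; try discriminate; auto.
  rewrite sub_bind by auto.
  rewrite (rbar_sub _ _ _ _ _ H), defined_option_map, (mor_sub _ _ _ _ _ H).
  set (ra := rbar m r E K1).
  change (match ra with Some _ => true | None => false end) with (defined ra).
  f_equal. rewrite <- (IHK2 _ _ _ _ _ HK (env_sub_ext (defined ra) _ _ _ _ H)).
  f_equal. simpl; f_equal.
  - rewrite sub_ren, ren_sub; apply sub_ext; intros; destruct (defined ra); simpl;
      unfold lift; now rewrite ?ren_ren.
  - now destruct (defined ra).
Qed.

Lemma Rel_ren xi zeta E E' A f :
  env_ren xi zeta E E' -> rel_of E' (ren xi A) (ren zeta f) = ren zeta (rel_of E A f).
Proof.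
  intros H; unfold rel_of; rewrite kindly_ren; destruct (kindly A).
  - now apply krel_ren.
  - simpl; now rewrite (tr_ren _ _ _ _ _ H).
Qed.

Lemma Rel_sub T sigma tau E E' A f :
  classifier T A -> env_sub sigma tau E E' ->
  rel_of E' (sub sigma A) (sub tau f) = sub tau (rel_of E A f).
Proof.
  intros HA H; unfold rel_of; rewrite (classifier_sub _ _ _ HA).
  destruct (kindly A) eqn:HK.
  - now apply krel_sub.
  - simpl; now rewrite (tr_sub _ _ _ _ _ H).
Qed.

(** The image of [Pi A B] below its outer abstraction, expressed by images computed in [E] and then
    lifted past [f], rather than by images in the shifted environment. *)
Definition pi_body (E : renv) (A : expr) (rb : expr) : expr :=
  let b := defined (rbar m r E A) in
  bind Pi (lift (mor m E A)) (option_map lift (rbar m r E A))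
    (App (ren (up_ren_if b S) rb) (App (Var (wk b 0)) (obj_var b))).

Lemma rbar_pi E A B :
  rbar m r E (Pi A B)
  = option_map (fun rb => Lam (mor m E (Pi A B)) (pi_body E A rb))
      (rbar m r (ext (defined (rbar m r E A)) E) B).
Proof.
  cbn [rbar]. rewrite rbar_shift, defined_option_map.
  set (ra := rbar m r E A).
  change (match ra with Some _ => true | None => false end) with (defined ra).
  rewrite <- (ren_id B) at 1.
  rewrite (rbar_ren _ _ _ _ _ (env_ren_ext_shift _ _)), option_map_map.
  destruct (rbar m r (ext (defined ra) E) B); simpl; auto. f_equal. f_equal.
  rewrite mor_shift; unfold pi_body; fold ra. now destruct ra.
Qed.

Lemma pi_body_sub1 E A rb f :
  let b := defined (rbar m r E A) in
  sub1 (pi_body E A rb) f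
  = bind Pi (mor m E A) (rbar m r E A) (App rb (App (ren (wk b) f) (obj_var b))).
Proof.
  unfold pi_body, sub1; simpl. rewrite sub_bind by auto.
  rewrite option_map_map. f_equal.
  - apply sub1_lift.
  - destruct (rbar m r E A); simpl; f_equal. apply sub1_lift.
  - destruct (rbar m r E A); simpl; f_equal; unfold lift; rewrite ?sub_ren, ?ren_ren; auto;
      rewrite <- (sub_var rb) at 2; apply sub_ext; intros [|[|i]]; auto.
Qed.

Lemma krel_red E K k f :
  kindly K = true -> rbar m r E K = Some k -> kind_red (App k f) (krel_of E K f).
Proof.
  revert E k f; induction K; intros E k f HK Hk; simpl in HK; try discriminate.
  - injection Hk as <-. apply kr_beta. simpl. apply kr_pi, kr_typ.
  - rewrite rbar_pi in Hk.
    destruct (rbar m r (ext _ E) K2) as [k2|] eqn:Hk2; try discriminate.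
    injection Hk as <-. apply kr_beta. rewrite pi_body_sub1; simpl.
    specialize (IHK2 _ _ (App (ren (wk (defined (rbar m r E K1))) f)
      (obj_var (defined (rbar m r E K1)))) HK Hk2).
    destruct (rbar m r E K1); simpl; auto using kind_red.
Qed.

Lemma kindly_krel E K f : kindly K = true -> kindly (krel_of E K f) = true.
Proof.
  revert E f; induction K; intros E f HK; simpl in *; try discriminate; auto.
  destruct (rbar m r E K1); simpl; auto.
Qed.

(** The image of a kind has [Typ] at its head, so its application to a family is no valid
    classifier. This eliminates the unreduced alternative of [has_type_red] at kinds. *)
Lemma rbar_kindly_not_family U E K k :
  kindly K = true -> rbar m r E K = Some k -> family U k = false.
Proof.
  revert E k; induction K; intros E k HK Hk; simpl in HK; try discriminate.
  - injection Hk as <-; reflexivity.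
  - rewrite rbar_pi in Hk.
    destruct (rbar m r (ext _ E) K2) as [k2|] eqn:Hk2; try discriminate.
    injection Hk as <-; simpl. unfold pi_body.
    destruct (rbar m r E K1); simpl; rewrite family_ren; eauto.
Qed.

Lemma family_bind U Q A ra e :
  (forall A B, family U (Q A B) = family U B) ->
  family U (bind Q A ra e) = family U e.
Proof. intros H; destruct ra; simpl; now rewrite !H. Qed.

(** The counterpart at types: the image is headed by a value of [r] that is a target family, so
    [kind_red] cannot succeed on it and the reduced alternative is eliminated. *)
Lemma family_rbar T U E A rA :
  (forall c B d rc, lookup T c = Some (B, d) -> kindly B = true ->
     r c = Some rc -> family U rc = true) ->
  family T A = true -> rbar m r E A = Some rA -> family U rA = true.
Proof.
  intros Hc. revert E rA; induction A; intros E rA HA HrA; simpl in HA; try discriminate.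
  - destruct (lookup T c) as [[B d]|] eqn:E'; try discriminate. eauto.
  - rewrite rbar_pi in HrA.
    destruct (rbar m r (ext _ E) A2) as [k2|] eqn:Hk2; try discriminate.
    injection HrA as <-; simpl. unfold pi_body. rewrite family_bind by auto; simpl.
    rewrite family_ren; eauto.
  - cbn [rbar] in HrA.
    destruct (rbar m r (ext _ E) A2) as [k2|] eqn:Hk2; try discriminate.
    injection HrA as <-. rewrite family_bind by auto; eauto.
  - cbn [rbar] in HrA. destruct (rbar m r E A1) eqn:Hf; try discriminate.
    destruct (rbar m r E A2); injection HrA as <-; simpl; eauto.
Qed.

End Syntax.

Lemma kind_red_fun C K : kind_red C K -> forall K', kind_red C K' -> K = K'.
Proof.
  induction 1; intros K' H'; inversion H'; subst; f_equal; auto.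
Qed.

Lemma family_not_kind_red U C K : kind_red C K -> family U C = false.
Proof.
  induction 1; simpl; auto.
  destruct (family U t) eqn:E; auto.
  rewrite <- IHkind_red; symmetry; now apply family_sub.
Qed.

(** * Typing of the target binders *)

Definition bctx (ra : option expr) (A : expr) (D : ctx) : ctx :=
  match ra with
  | Some a => App (lift a) (Var 0) :: A :: D
  | None => A :: D
  end.

Definition bapp (b : bool) (f s s' : expr) : expr :=
  if b then App (App f s) s' else App f s.

Definition lift_if (b : bool) (e : expr) : expr := if b then lift e else e.

Lemma bapp_obj_sub e b s s' : sub (inst b s s') (ren (wk b) e) = e.
Proof.
  rewrite sub_ren; rewrite <- (sub_var e) at 2; apply sub_ext; intros; now destruct b.
Qed.

Section Target.

Variable U : theory.
Hypothesis HU : closed_theory U.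

Definition orel (D : ctx) (A : expr) (ra ra' : option expr) : Prop :=
  match ra, ra' with
  | Some a, Some a' => aeq U D a a' (Some (Pi A Typ))
  | None, None => True
  | _, _ => False
  end.

Lemma companion_eq D A a a' f f' :
  aeq U D a a' (Some (Pi A Typ)) -> aeq U D f f' (Some A) ->
  aeq U D (App a f) (App a' f') (Some Typ).
Proof. intros Ha Hf. apply (aeq_app' U HU D a a' f f' A Typ); auto. Qed.

Lemma companion_lift_eq D A a a' :
  aeq U D a a' (Some (Pi A Typ)) ->
  aeq U (A :: D) (App (lift a) (Var 0)) (App (lift a') (Var 0)) (Some Typ).
Proof.
  intros Ha. destruct (aeq_valid _ _ _ _ _ Ha) as (HP & _).
  destruct (aok_pi_inv _ _ _ _ HP) as (HA & _).
  apply companion_eq with (lift A).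
  - apply (aeq_lift U HU _ _ _ _ (Some (Pi A Typ))); auto.
  - apply aeq_refl', aty_var0; auto.
Qed.

Lemma orel_refl_l D A ra ra' : orel D A ra ra' -> orel D A ra ra.
Proof.
  destruct ra as [a|], ra' as [a'|]; simpl; try tauto.
  intros H; apply aeq_refl'; apply (aeq_valid _ _ _ _ _ H).
Qed.

Lemma awf_bctx D A ra :
  aty U D A (Some Typ) -> orel D A ra ra -> awf U (bctx ra A D).
Proof.
  intros HA Hra. assert (HAD : awf U (A :: D)) by (constructor; eauto using aty_wf).
  destruct ra as [a|]; simpl in *; auto. constructor; auto.
  eapply aeq_valid, companion_lift_eq; eauto.
Qed.

Lemma bind_pi_eq D A A' ra ra' B B' s :
  sort s -> aeq U D A A' (Some Typ) -> orel D A ra ra' ->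
  aeq U (bctx ra A D) B B' s ->
  aeq U D (bind Pi A ra B) (bind Pi A' ra' B') s.
Proof.
  intros Hs HA Hra HB; destruct ra as [a|], ra' as [a'|]; simpl in *; try tauto;
    repeat apply aeq_pi'; auto using companion_lift_eq.
Qed.

Lemma bind_lam_eq D A A' ra ra' t t' C :
  aeq U D A A' (Some Typ) -> orel D A ra ra' ->
  aeq U (bctx ra A D) t t' (Some C) ->
  aeq U D (bind Lam A ra t) (bind Lam A' ra' t') (Some (bind Pi A ra C)).
Proof.
  intros HA Hra Ht; destruct ra as [a|], ra' as [a'|]; simpl in *; try tauto;
    repeat apply aeq_lam'; auto using companion_lift_eq.
Qed.

Lemma sub1_companion a s : sub1 (App (lift a) (Var 0)) s = App a s.
Proof. unfold sub1; simpl; f_equal; apply sub1_lift. Qed.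

Lemma sub1_up_inst C s u :
  sub1 (sub (up_sub (fun i => match i with 0 => s | S j => Var j end)) C) u
  = sub (inst true s u) C.
Proof.
  unfold sub1; rewrite sub_sub; apply sub_ext; intros [|[|i]]; simpl; auto.
  apply sub1_lift.
Qed.

Lemma bapp_eq D A ra C f f' s s' u u' :
  aeq U D f f' (Some (bind Pi A ra C)) -> aeq U D s s' (Some A) ->
  (forall a, ra = Some a -> aeq U D u u' (Some (App a s))) ->
  aeq U D (bapp (defined ra) f s u) (bapp (defined ra) f' s' u')
    (Some (sub (inst (defined ra) s u) C)).
Proof.
  intros Hf Hs Hu; destruct ra as [a|]; simpl in *.
  - specialize (Hu a eq_refl). rewrite <- sub1_up_inst.
    apply aeq_app' with (App a s); auto.
    rewrite <- (sub1_companion a s) at 1.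
    exact (aeq_app' U HU _ _ _ _ _ _ _ Hf Hs).
  - exact (aeq_app' U HU _ _ _ _ _ _ _ Hf Hs).
Qed.

Lemma bind_beta D A ra t C s u :
  aty U (bctx ra A D) t (Some C) -> aty U D s (Some A) ->
  (forall a, ra = Some a -> aty U D u (Some (App a s))) ->
  aeq U D (bapp (defined ra) (bind Lam A ra t) s u)
    (sub (inst (defined ra) s u) t) (Some (sub (inst (defined ra) s u) C)).
Proof.
  intros Ht Hs Hu; destruct ra as [a|]; simpl in *.
  - specialize (Hu a eq_refl). rewrite <- !sub1_up_inst.
    set (sg := fun i => match i with 0 => s | S j => Var j end).
    assert (Hwf := aty_wf _ _ _ _ Ht). inversion Hwf as [|? ? HAD HX]; subst.
    assert (HD := aty_wf _ _ _ _ Hs).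
    assert (HX' := aty_sub1 U HU _ _ _ _ _ Hs HX). rewrite sub1_companion in HX'; simpl in HX'.
    (* With a companion there are two contractions. The first instantiates [x], also in the type of
       the companion, and the body must be retyped there before the second. *)
    assert (Ht' : aty U (App a s :: D) (sub (up_sub sg) t) (Some (sub (up_sub sg) C))).
    { eapply annotated_sub with (C := Some C); eauto.
      - constructor; auto.
      - rewrite <- (sub1_companion a s). apply sub_ok_up; auto.
        + apply sub1_sub_ok; auto.
        + fold (sub1 (App (lift a) (Var 0)) s). now rewrite sub1_companion. }
    eapply aeq_trans'.
    + apply aeq_app' with (App a s); [auto| |apply aeq_refl'; auto].
      pose proof (aeq_beta' U HU _ _ _ _ _ (aty_lam' U _ _ _ _ HX Ht) Hs) as HB.
      unfold sub1 in HB; simpl in HB. fold sg in HB.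
      fold (sub1 (lift a) s) in HB. change (sub sg (lift a)) with (sub1 (lift a) s) in HB.
      rewrite sub1_lift in HB. exact HB.
    + apply aeq_beta'; auto.
  - apply aeq_beta'; auto.
Qed.

(** With a companion this takes two eta steps: an inner one on [f x] under the object binder, then
    an outer one on [f]. *)
Lemma bind_eta D A ra f C :
  aty U D f (Some (bind Pi A ra C)) ->
  let b := defined ra in
  aeq U D (bind Lam A ra (bapp b (ren (wk b) f) (obj_var b) (Var 0))) f
    (Some (bind Pi A ra C)).
Proof.
  intros Hf b; subst b; destruct ra as [a|]; simpl in *; [|apply aeq_eta'; auto].
  set (X := App (lift a) (Var 0)) in *.
  destruct (aok_pi_inv _ _ _ _ (aty_ok _ _ _ _ Hf)) as (HA & HB).
  apply aeq_trans' with (Lam A (App (lift f) (Var 0))); [|apply aeq_eta'; auto].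
  apply aeq_lam'; auto using aeq_refl'.
  assert (Hf' : aty U (A :: D) (App (lift f) (Var 0)) (Some (Pi X C))).
  { rewrite <- (sub1_up_lift (Pi X C)). apply aty_app' with (lift A); auto using aty_var0.
    apply (aty_lift U HU _ _ _ (Some (Pi A (Pi X C)))); auto. }
  pose proof (aeq_eta' U HU _ _ _ _ Hf') as H. simpl in H.
  unfold lift in H at 1; simpl in H.
  replace (ren (wk true) f) with (ren S (lift f)); auto.
  unfold lift; rewrite ren_ren; apply ren_ext; auto.
Qed.

Lemma aeq_lift_bctx D A ra t u C :
  aty U D A (Some Typ) -> orel D A ra ra -> aeq U (A :: D) t u (Some C) ->
  aeq U (bctx ra A D) (lift_if (defined ra) t) (lift_if (defined ra) u)
    (Some (lift_if (defined ra) C)).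
Proof.
  intros HA Hra H; destruct ra as [a|]; simpl in *; auto.
  apply (aeq_lift U HU _ _ _ _ (Some C)); auto.
  eapply aeq_valid, companion_lift_eq; eauto.
Qed.

Lemma obj_app_lift b f :
  App (ren (wk b) f) (obj_var b) = lift_if b (App (lift f) (Var 0)).
Proof.
  destruct b; simpl; auto. unfold lift at 1; simpl; f_equal.
  unfold lift; rewrite ren_ren; apply ren_ext; auto.
Qed.

Lemma obj_app_eq D A ra B f f' :
  aeq U D f f' (Some (Pi A B)) -> orel D A ra ra ->
  let b := defined ra in
  aeq U (bctx ra A D) (App (ren (wk b) f) (obj_var b)) (App (ren (wk b) f') (obj_var b))
    (Some (lift_if b B)).
Proof.
  intros Hf Hra b. destruct (aeq_valid _ _ _ _ _ Hf) as (HP & _).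
  destruct (aok_pi_inv _ _ _ _ HP) as (HA & _).
  rewrite !obj_app_lift. apply aeq_lift_bctx; auto.
  rewrite <- (sub1_up_lift B). apply aeq_app' with (lift A); auto.
  - apply (aeq_lift U HU _ _ _ _ (Some (Pi A B))); auto.
  - apply aeq_refl', aty_var0; auto.
Qed.

Lemma obj_beta D A ra B t :
  aty U (A :: D) t (Some B) -> orel D A ra ra ->
  let b := defined ra in
  aeq U (bctx ra A D) (App (ren (wk b) (Lam A t)) (obj_var b)) (lift_if b t)
    (Some (lift_if b B)).
Proof.
  intros Ht Hra b.
  assert (Hwf := aty_wf _ _ _ _ Ht). inversion Hwf as [|? ? HAD HA]; subst.
  rewrite obj_app_lift. apply aeq_lift_bctx; auto.
  rewrite <- (sub1_up_lift B). rewrite <- (sub1_up_lift t) at 2.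
  apply aeq_beta'; auto using aty_var0.
  eapply annotated_ren with (C := Some B); eauto.
  - constructor; auto. apply (aty_lift U HU _ _ _ (Some Typ)); auto.
  - apply ren_ok_up, ren_ok_S.
Qed.

End Target.

(** * Images under the morphism, translated contexts and values of constants *)

Section Morphism.

Variables (T U : theory) (m : cname -> expr) (r : cname -> option expr).
Hypothesis HT : valid_theory T.
Hypothesis HU : valid_theory U.
Hypothesis HC : closed_values m r.
Hypothesis HM : is_morphism T U m.
Let HUc : closed_theory U := proj1 HU.

(* Separate from [fundamental], whose contexts contain variables [x^*] that
   [mbar t] does not mention: extracting this from there would need
   strengthening. *)
Lemma mbar_typed :
  (forall G, awf T G -> awf U (map (mbar m) G)) /\
  (forall G C, aok T G C -> awf U (map (mbar m) G)) /\
  (forall G t C, aty T G t C -> awf U (map (mbar m) G) /\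
     aty U (map (mbar m) G) (mbar m t) (option_map (mbar m) C)) /\
  (forall G t u C, aeq T G t u C -> awf U (map (mbar m) G) /\
     aeq U (map (mbar m) G) (mbar m t) (mbar m u) (option_map (mbar m) C)).
Proof.
  pose proof (annotated_complete U HU) as (_ & _ & Hct & _ & Hce).
  apply annotated_ind; simpl; intros;
    repeat match goal with H : _ /\ _ |- _ => destruct H end;
    try match goal with |- _ /\ _ => split; auto end;
    try match goal with H : sort ?s |- _ =>
      rewrite (sort_map (mbar m) s H eq_refl) in * end;
    unfold lift in *; rewrite ?(mbar_sub1 m r HC), ?(mbar_ren m r HC) in *;
    simpl in *; auto.
  - constructor.
  - now constructor.
  - now constructor.
  - apply aty_weaken_nil; auto. apply Hct. eapply HM; eauto.
  - apply aty_var; auto.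
    + rewrite nth_error_map. now rewrite H1.
    + apply awf_nth; auto. rewrite nth_error_map. now rewrite H1.
  - now apply aty_pi.
  - apply aty_lam'; auto.
  - eapply aty_app'; eauto.
  - eapply aty_conv'; eauto.
  - apply aeq_refl'; auto.
  - apply aeq_sym'; auto.
  - eapply aeq_trans'; eauto.
  - apply aeq_pi'; auto.
  - apply aeq_lam'; auto.
  - eapply aeq_app'; eauto.
  - apply aeq_beta'; auto.
  - apply aeq_eta'; auto.
  - match goal with H : lookup T c = _ |- _ => destruct (HM _ _ _ H) as [_ Hd] end.
    apply aeq_weaken_nil; auto.
  - eapply aeq_conv'; eauto.
Qed.

(** * The translated context *)

Notation env := (renv_of m r).
Notation rctx := (rctx m r).
Notation mor := (mor m).
Notation tr := (rval m r).
Notation rbar := (rbar m r).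
Notation krel := (krel_of m r).
Notation Rel := (rel_of m r).

Lemma rctx_cons G A :
  rctx (A :: G) = bctx (rbar (env G) A) (mor (env G) A) (rctx G).
Proof. reflexivity. Qed.

Lemma env_cons G A : env (A :: G) = ext (defined (rbar (env G) A)) (env G).
Proof. reflexivity. Qed.

Lemma nth_bctx ra A D n : nth_error (bctx ra A D) (wk (defined ra) n) = nth_error D n.
Proof. now destruct ra. Qed.

Lemma ren_plus_wk b n (e : expr) :
  ren (fun j => S (wk b n) + j) e = ren (wk b) (ren (fun j => S n + j) e).
Proof. rewrite ren_ren; apply ren_ext; intros; now destruct b. Qed.

Lemma ren_plus_S n (e : expr) :
  ren (fun j => S (S n) + j) e = lift (ren (fun j => S n + j) e).
Proof. unfold lift; rewrite ren_ren; apply ren_ext; auto. Qed.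

Lemma obj_lookup G i A :
  nth_error G i = Some A -> exists B,
    nth_error (rctx G) (obj (env G) i) = Some B /\
    ren (fun j => S (obj (env G) i) + j) B
    = mor (env G) (ren (fun j => S i + j) A).
Proof.
  revert i; induction G as [|A' G IH]; intros [|i] Hi; simpl nth_error in Hi;
    try discriminate; rewrite rctx_cons, env_cons.
  - injection Hi as ->. exists (mor (env G) A).
    change (ren (fun j => 1 + j) A) with (lift A). rewrite (mor_wk m r HC).
    destruct (rbar (env G) A); auto.
  - destruct (IH _ Hi) as (B & HB & E). exists B.
    replace (obj (ext (defined (rbar (env G) A')) (env G)) (S i))
      with (wk (defined (rbar (env G) A')) (obj (env G) i))
      by now destruct (rbar (env G) A').
    now rewrite nth_bctx, ren_plus_wk, E, ren_plus_S, (mor_wk m r HC).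
Qed.

Lemma star_lookup G i A k :
  nth_error G i = Some A -> star (env G) i = Some k -> exists B,
    nth_error (rctx G) k = Some B /\
    ren (fun j => S k + j) B
    = App (tr (env G) (ren (fun j => S i + j) A)) (Var (obj (env G) i)).
Proof.
  revert i k; induction G as [|A' G IH]; intros [|i] k Hi Hk; simpl nth_error in Hi;
    try discriminate; rewrite rctx_cons, env_cons in *.
  - injection Hi as ->.
    change (ren (fun j => 1 + j) A) with (lift A).
    rewrite (tr_ren m r HC _ _ _ _ _ (env_ren_wk _ _)). unfold rval.
    destruct (rbar (env G) A) as [a|]; simpl in Hk; try discriminate.
    injection Hk as <-. simpl. eexists; split; [reflexivity|]. simpl; f_equal.
    unfold lift; rewrite ren_ren; apply ren_ext; auto.
  - set (b := defined (rbar (env G) A')) in *.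
    assert (Hk' : exists k', star (env G) i = Some k' /\ k = wk b k').
    { destruct b; simpl in Hk; destruct (star (env G) i); simpl in Hk;
        try discriminate; injection Hk as <-; eauto. }
    destruct Hk' as (k' & Hk' & ->).
    destruct (IH _ _ Hi Hk') as (B & HB & E). exists B. unfold b at 1.
    rewrite nth_bctx, ren_plus_wk, E, ren_plus_S.
    rewrite (tr_ren m r HC _ _ _ _ _ (env_ren_wk b _)).
    split; auto. simpl; f_equal; f_equal. now destruct b.
Qed.

(** Seen through the object variables, the translated context is a weakening of the context
    translated by [mbar]. Typing and equality of [mor] images thus follow from [mbar_typed] by
    renaming. *)
Lemma obj_ren_ok G : ren_ok (rctx G) (obj (env G)) (map (mbar m) G).
Proof.
  intros i A Hi. rewrite nth_error_map in Hi.
  destruct (nth_error G i) as [A'|] eqn:Hi'; simpl in Hi; try discriminate.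
  injection Hi as <-. destruct (obj_lookup _ _ _ Hi') as (B & HB & E).
  exists B; split; auto. rewrite E. unfold Defs.mor. now rewrite (mbar_ren m r HC).
Qed.

Lemma mor_eq G t u C :
  awf U (rctx G) -> aeq T G t u C ->
  aeq U (rctx G) (mor (env G) t) (mor (env G) u) (option_map (mor (env G)) C).
Proof.
  intros HD H. apply mbar_typed in H as [_ H].
  eapply annotated_ren in H; eauto using obj_ren_ok.
  now rewrite option_map_map in H.
Qed.

Lemma mor_typed G t C :
  awf U (rctx G) -> aty T G t C ->
  aty U (rctx G) (mor (env G) t) (option_map (mor (env G)) C).
Proof.
  intros HD H. apply aeq_refl', mor_eq in H; auto. apply (aeq_valid _ _ _ _ _ H).
Qed.

(** * Constants *)

Hypothesis HR : partial_logrel T U m r.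

(** The conditions on [r] are stated in the empty environment. For closed expressions this renaming
    turns them into statements in any translated context. *)
Lemma renv0_env G :
  env_ren (fun i => length G + i) (fun i => length (rctx G) + i) renv0 (env G).
Proof.
  induction G as [|A G IH]; intros i; [simpl; auto|].
  rewrite rctx_cons, env_cons. destruct (IH i) as [H1 H2].
  destruct (rbar (env G) A); simpl in *; rewrite H1, H2; auto.
Qed.

Lemma Rel_renv0 G A f :
  closed A -> closed f ->
  Rel (env G) A f = ren (fun i => length (rctx G) + i) (Rel renv0 A f).
Proof.
  intros HA Hf. rewrite <- (Rel_ren m r HC _ _ _ _ _ _ (renv0_env G)).
  now rewrite !closed_ren.
Qed.

Lemma tr_renv0 G A :
  closed A -> tr (env G) A = ren (fun i => length (rctx G) + i) (tr renv0 A).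
Proof.
  intros HA. rewrite <- (tr_ren m r HC _ _ _ _ _ (renv0_env G)).
  now rewrite closed_ren.
Qed.

Lemma mor_renv0 E A : closed A -> closed (mbar m A) -> mor E A = mbar m A.
Proof. intros HA HA'; unfold Defs.mor; now apply closed_ren. Qed.

Lemma not_has_type_red_kind G t K k f :
  kindly K = true -> rbar renv0 K = Some k -> ~ has_type U G t (App k f).
Proof.
  intros HK Hk H. apply (annotated_complete U HU) in H.
  apply aty_ok, aok_classifier in H. destruct H as [H|[_ H]]; simpl in H; try discriminate.
  erewrite rbar_kindly_not_family in H; eauto. discriminate.
Qed.

Lemma const_kind_typed c A d rc :
  lookup T c = Some (A, d) -> kindly A = true -> r c = Some rc ->
  aty U [] rc (Some (krel renv0 A (m c))).
Proof.
  intros Hc HA Hrc. destruct (HR _ _ _ Hc) as [H _].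
  destruct (H _ Hrc) as (rA & HrA & [Ht|(K & HK & Ht)]).
  - exfalso; eapply not_has_type_red_kind; eauto.
  - apply (annotated_complete U HU).
    erewrite kind_red_fun; [exact Ht| |exact HK]. now apply krel_red.
Qed.

Lemma rbar_family A rA E :
  family T A = true -> rbar E A = Some rA -> family U rA = true.
Proof.
  apply (family_rbar m r HC T U E A rA). intros c B d rc Hc HB Hrc.
  eapply aty_family; [eapply const_kind_typed; eauto|]. now apply kindly_krel.
Qed.

(** The level of [A] selects the alternative that can hold. [J] abstracts over typing and equality,
    so that one argument serves declarations and definitions. *)
Lemma red_classifier (J : expr -> Prop) A rA f :
  (forall C, J C -> exists t, has_type U [] t C) ->
  classifier T A -> rbar renv0 A = Some rA ->
  J (App rA f) \/ (exists K, kind_red (App rA f) K /\ J K) ->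
  J (Rel renv0 A f).
Proof.
  intros HJ HA HrA HJA. unfold rel_of.
  destruct HA as [HA|[HA HF]]; rewrite HA; destruct HJA as [H|(K & HK & H)].
  - destruct (HJ _ H) as [t Ht]. exfalso; eapply not_has_type_red_kind; eauto.
  - erewrite kind_red_fun; [exact H| |exact HK]. now apply krel_red.
  - now rewrite (tr_some _ _ _ _ _ HrA).
  - exfalso. apply (family_not_kind_red U) in HK; simpl in HK.
    rewrite (rbar_family A rA renv0) in HK; congruence.
Qed.

Lemma const_classifier c A d :
  lookup T c = Some (A, d) -> classifier T A /\ closed A.
Proof.
  intros Hc. destruct (proj2 HT _ _ _ Hc) as [HA _].
  eauto using aok_classifier, aok_closed.
Qed.

Lemma closed_const c : closed (Const c).
Proof. intros s; reflexivity. Qed.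

Lemma lift_closed_eq G t u A f :
  awf U (rctx G) -> closed A -> closed f -> closed t -> closed u ->
  aeq U [] (tr renv0 t) (tr renv0 u) (Some (Rel renv0 A f)) ->
  aeq U (rctx G) (tr (env G) t) (tr (env G) u) (Some (Rel (env G) A f)).
Proof.
  intros HD HA Hf Ht Hu H. rewrite Rel_renv0, !tr_renv0 by auto.
  eapply annotated_ren with (C := Some _) in H; eauto using ren_ok_nil.
Qed.

Lemma eq_expr_typed D t u A : eq_expr U D t u A -> has_type U D t A.
Proof.
  intros H; apply (annotated_complete U HU) in H.
  destruct (aeq_valid _ _ _ _ _ H) as (_ & H' & _).
  now apply annotated_sound in H'.
Qed.

Lemma const_rel G c A d :
  awf U (rctx G) -> lookup T c = Some (A, d) -> defined (r c) = true ->
  aeq U (rctx G) (tr (env G) (Const c)) (tr (env G) (Const c))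
    (Some (Rel (env G) A (mor (env G) (Const c)))).
Proof.
  intros HD Hc Hd. apply defined_some in Hd as [rc Hrc].
  destruct (const_classifier _ _ _ Hc) as [HA HAc].
  rewrite mor_renv0 by (apply HC || apply closed_const).
  apply lift_closed_eq; auto using closed_const; [apply HC|].
  rewrite (tr_some m r renv0 (Const c) rc) by auto.
  destruct (HR _ _ _ Hc) as [H _]. destruct (H _ Hrc) as (rA & HrA & Ht).
  apply aeq_refl', (annotated_complete U HU).
  apply red_classifier with (J := has_type U [] rc) (rA := rA); eauto.
Qed.

Lemma delta_rel G c A t :
  awf U (rctx G) -> lookup T c = Some (A, Some t) -> defined (r c) = true ->
  aeq U (rctx G) (tr (env G) (Const c)) (tr (env G) t)
    (Some (Rel (env G) A (mor (env G) (Const c)))).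
Proof.
  intros HD Hc Hd. apply defined_some in Hd as [rc Hrc].
  destruct (const_classifier _ _ _ Hc) as [HA HAc].
  destruct (proj2 HT _ _ _ Hc) as [_ Ht]. specialize (Ht _ eq_refl).
  rewrite mor_renv0 by (apply HC || apply closed_const).
  apply lift_closed_eq; eauto using aty_closed, closed_const; [apply HC|].
  rewrite (tr_some m r renv0 (Const c) rc) by auto.
  destruct (HR _ _ _ Hc) as [H1 H2]. destruct (H1 _ Hrc) as (rA & HrA & _).
  destruct (H2 _ eq_refl) as [Hdef Heq].
  destruct (rbar renv0 t) as [rt|] eqn:Hrt;
    [|exfalso; destruct Hdef as [Hdef _]; apply Hdef; congruence].
  rewrite (tr_some _ _ _ _ _ Hrt).
  apply (annotated_complete U HU).
  apply red_classifier with (J := eq_expr U [] rc rt) (rA := rA);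
    eauto using eq_expr_typed.
  now apply Heq.
Qed.

End Morphism.

(** * Preservation of typing and equality under term totality *)

Section Fundamental.

Variables (T U : theory) (m : cname -> expr) (r : cname -> option expr).
Hypothesis HT : valid_theory T.
Hypothesis HU : valid_theory U.
Hypothesis HC : closed_values m r.
Hypothesis HM : is_morphism T U m.
Hypothesis HR : partial_logrel T U m r.
Hypothesis Htt : term_total T m r.
Let HUc : closed_theory U := proj1 HU.

Notation env := (renv_of m r).
Notation rctx := (rctx m r).
Notation mor := (mor m).
Notation tr := (rval m r).
Notation rbar := (rbar m r).
Notation krel := (krel_of m r).
Notation Rel := (rel_of m r).

(* By term totality this tells whether [rbar t] is defined, for [t : A]. *)
Definition rdef (t A : expr) : bool :=
  if kindly A then head_defined r t else head_defined r A.

Lemma defined_rdef G t A :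
  aty T G t (Some A) -> defined (rbar (env G) t) = rdef t A.
Proof.
  intros H; unfold rdef. destruct (kindly A) eqn:HA.
  - apply defined_rbar with T. right; eapply aty_family; eauto.
  - apply eq_true_iff_eq.
    eapply (defined_term_classifier T U) in H; eauto. destruct H; split; auto.
Qed.

Lemma rdef_eq G t u A : aeq T G t u (Some A) -> rdef t A = rdef u A.
Proof.
  intros H; unfold rdef. destruct (kindly A) eqn:HA; auto.
  eapply (head_defined_eq T U); eauto.
Qed.

Lemma rdef_type A : rdef A Typ = head_defined r A.
Proof. reflexivity. Qed.

(** At kinds two equal families [f] and [f'] are used, so that the clause also says that the
    relation respects equality of its argument; [Rel_eq] relies on this. *)
Definition sem (G : ctx) (t u : expr) (C : option expr) : Prop :=
  match C with
  | None => forall f f', aeq U (rctx G) f f' (Some (mor (env G) t)) ->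
      aeq U (rctx G) (krel (env G) t f) (krel (env G) u f') None
  | Some A => rdef t A = true ->
      aeq U (rctx G) (tr (env G) t) (tr (env G) u) (Some (Rel (env G) A (mor (env G) t)))
  end.

Definition sem_ok (G : ctx) (A : expr) : Prop :=
  exists s, sort s /\ aty T G A s /\ sem G A A s.

Lemma Rel_eq G A A' s f f' :
  sort s -> aeq T G A A' s -> sem G A A' s -> head_defined r A = true ->
  aeq U (rctx G) f f' (Some (mor (env G) A)) ->
  aeq U (rctx G) (Rel (env G) A f) (Rel (env G) A' f') s.
Proof.
  intros Hs E H Hd Hf. destruct (aeq_valid _ _ _ _ _ E) as (_ & HA & HA').
  unfold rel_of. destruct Hs as [-> | ->].
  - rewrite (aty_kind _ _ _ HA), (aty_kind _ _ _ HA'). auto.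
  - rewrite (family_not_kindly _ _ (aty_type _ _ _ HA)),
      (family_not_kindly _ _ (aty_type _ _ _ HA')).
    apply companion_eq with (mor (env G) A); auto.
Qed.

Lemma Rel_ok_eq G A f f' :
  sem_ok G A -> head_defined r A = true ->
  aeq U (rctx G) f f' (Some (mor (env G) A)) ->
  exists s, sort s /\ aeq U (rctx G) (Rel (env G) A f) (Rel (env G) A f') s.
Proof.
  intros (s & Hs & HA & H) Hd Hf. exists s; split; auto.
  apply Rel_eq; auto using aeq_refl'.
Qed.

(** Definedness is invariant under conversion, so equal types either both introduce a companion or
    both do not. *)
Lemma sem_orel G A A' :
  aeq T G A A' (Some Typ) -> sem G A A' (Some Typ) ->
  orel U (rctx G) (mor (env G) A) (rbar (env G) A) (rbar (env G) A').
Proof.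
  intros E H. destruct (aeq_valid _ _ _ _ _ E) as (_ & HA & HA').
  pose proof (defined_rdef _ _ _ HA) as D. pose proof (defined_rdef _ _ _ HA') as D'.
  rewrite <- (rdef_eq _ _ _ _ E) in D'. simpl in H. unfold rval in H.
  destruct (rbar (env G) A), (rbar (env G) A'); simpl in *; auto; congruence.
Qed.

Lemma env_cons_eq G A A' :
  aeq T G A A' (Some Typ) -> defined (rbar (env G) A') = defined (rbar (env G) A).
Proof.
  intros E. destruct (aeq_valid _ _ _ _ _ E) as (_ & HA & HA').
  rewrite (defined_rdef _ _ _ HA), (defined_rdef _ _ _ HA').
  symmetry; eapply rdef_eq; eauto.
Qed.

Lemma head_defined_cls G A t :
  aty T G t (Some A) -> rdef t A = true -> head_defined r A = true.
Proof.
  unfold rdef; intros H. destruct (kindly A) eqn:HA; auto.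
  intros _; now apply head_defined_kindly.
Qed.

(** The object part never mentions [x^*], which is the innermost variable when it is present. *)
Lemma mor_ext b E B : mor (ext b E) B = lift_if b (mor (ext false E) B).
Proof.
  destruct b; simpl; auto. unfold Defs.mor, lift; rewrite ren_ren.
  apply ren_ext; intros [|i]; auto.
Qed.

Lemma obj_app_typed G A B f f' :
  orel U (rctx G) (mor (env G) A) (rbar (env G) A) (rbar (env G) A) ->
  aeq U (rctx G) f f' (Some (mor (env G) (Pi A B))) ->
  let b := defined (rbar (env G) A) in
  aeq U (rctx (A :: G)) (App (ren (wk b) f) (obj_var b)) (App (ren (wk b) f') (obj_var b))
    (Some (mor (env (A :: G)) B)).
Proof.
  intros Ho Hf b. rewrite rctx_cons, env_cons. fold b. rewrite mor_ext.
  rewrite mor_pi in Hf. apply obj_app_eq; auto.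
Qed.

Lemma defined_lift ra : defined (option_map lift ra) = defined ra.
Proof. now destruct ra. Qed.

Lemma orel_lift D F A ra ra' :
  aty U D F (Some Typ) -> orel U D A ra ra' ->
  orel U (F :: D) (lift A) (option_map lift ra) (option_map lift ra').
Proof.
  intros HF; destruct ra, ra'; simpl; auto.
  intros H; apply (aeq_lift U HUc _ _ _ _ (Some (Pi A Typ))); auto.
Qed.

Lemma ren_ok_bctx D F A ra :
  ren_ok (bctx (option_map lift ra) (lift A) (F :: D)) (up_ren_if (defined ra) S)
    (bctx ra A D).
Proof.
  destruct ra as [a|]; simpl.
  - replace (App (lift (lift a)) (Var 0)) with (ren (up_ren S) (App (lift a) (Var 0)))
      by (simpl; now rewrite ren_lift).
    apply ren_ok_up, ren_ok_up, ren_ok_S.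
  - apply ren_ok_up, ren_ok_S.
Qed.

Lemma pi_body_eq G A A' B rb rb' :
  awf U (rctx G) -> aeq T G A A' (Some Typ) -> sem G A A' (Some Typ) ->
  aty U (rctx G) (mor (env G) (Pi A B)) (Some Typ) ->
  aeq U (rctx (A :: G)) rb rb' (Some (Pi (mor (env (A :: G)) B) Typ)) ->
  aeq U (mor (env G) (Pi A B) :: rctx G)
    (pi_body m r (env G) A rb) (pi_body m r (env G) A' rb') (Some Typ).
Proof.
  intros HD E H HF Hrb. unfold pi_body. rewrite (env_cons_eq _ _ _ E).
  pose proof (sem_orel _ _ _ E H) as Ho.
  pose proof (mor_eq T U m r HU HC HM _ _ _ _ HD E) as EA; simpl in EA.
  set (F := mor (env G) (Pi A B)) in *. set (ra := rbar (env G) A) in *.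
  assert (EA' : aeq U (F :: rctx G) (lift (mor (env G) A)) (lift (mor (env G) A')) (Some Typ))
    by (apply (aeq_lift U HUc _ _ _ _ (Some Typ)); auto).
  assert (Ho' := orel_lift _ F _ _ _ HF Ho). assert (Ho'' := orel_refl_l _ _ _ _ _ Ho').
  apply bind_pi_eq; auto.
  set (b := defined ra) in *.
  apply companion_eq with (ren (up_ren_if b S) (mor (env (A :: G)) B)); auto.
  - eapply annotated_ren with (C := Some (Pi _ Typ)) in Hrb; eauto.
    + apply awf_bctx; auto. apply (aeq_valid _ _ _ _ _ EA').
    + apply ren_ok_bctx.
  - assert (HV : aeq U (F :: rctx G) (Var 0) (Var 0)
      (Some (Pi (lift (mor (env G) A)) (ren (up_ren S) (mor (ext false (env G)) B))))).
    { apply aeq_refl'. change (Pi _ _) with (lift (Pi (mor (env G) A) (mor (ext false (env G)) B))).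
      rewrite <- mor_pi. apply aty_var0; auto. }
    apply (obj_app_eq U HUc) with (1 := HV) in Ho''. rewrite defined_lift in Ho''.
    fold b in Ho''. rewrite env_cons. fold ra b. rewrite mor_ext.
    replace (ren (up_ren_if b S) (lift_if b (mor (ext false (env G)) B)))
      with (lift_if b (ren (up_ren S) (mor (ext false (env G)) B))); auto.
    destruct b; simpl; auto. now rewrite ren_lift.
Qed.

(* At a kind both sides agree syntactically; at a type the left one is the
   application of an abstraction, and this is a beta step. *)
Lemma Rel_pi G A B f :
  awf U (rctx G) -> aty T G A (Some Typ) -> sem G A A (Some Typ) -> sem_ok (A :: G) B ->
  head_defined r B = true -> aty U (rctx G) f (Some (mor (env G) (Pi A B))) ->
  let b := defined (rbar (env G) A) in
  exists s, sort s /\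
    aeq U (rctx G) (Rel (env G) (Pi A B) f)
      (bind Pi (mor (env G) A) (rbar (env G) A)
        (Rel (env (A :: G)) B (App (ren (wk b) f) (obj_var b)))) s.
Proof.
  intros HD HA H HB Hd Hf b.
  pose proof (sem_orel _ _ _ (aeq_refl' _ _ _ _ HA) H) as Ho.
  pose proof (mor_typed T U m r HU HC HM _ _ _ HD HA) as HA'.
  pose proof (obj_app_typed _ _ _ _ _ Ho (aeq_refl' _ _ _ _ Hf)) as Hx. fold b in Hx.
  destruct HB as (s & Hs & HB & HBs).
  assert (HR' : aeq U (rctx G)
    (bind Pi (mor (env G) A) (rbar (env G) A)
        (Rel (env (A :: G)) B (App (ren (wk b) f) (obj_var b))))
    (bind Pi (mor (env G) A) (rbar (env G) A)
        (Rel (env (A :: G)) B (App (ren (wk b) f) (obj_var b)))) s).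
  { apply bind_pi_eq; auto using aeq_refl'.
    apply (Rel_eq (A :: G) B B); auto using aeq_refl'. }
  exists s; split; auto.
  destruct Hs as [-> | ->].
  - unfold rel_of in *; simpl. rewrite (aty_kind _ _ _ HB) in *. exact HR'.
  - assert (HBf := aty_type _ _ _ HB).
    assert (HK := family_not_kindly _ _ HBf).
    unfold rel_of in *; simpl; rewrite HK in *.
    assert (Hdef : defined (rbar (env (A :: G)) B) = true)
      by (rewrite (defined_rbar T); auto).
    rewrite env_cons in Hdef.
    unfold rval at 1. rewrite (rbar_pi m r HC), (tr_eq _ _ _ _ Hdef); simpl get.
    rewrite <- env_cons.
    assert (HP : aty T G (Pi A B) (Some Typ)) by (apply aty_pi; auto).
    pose proof (mor_typed T U m r HU HC HM _ _ _ HD HP) as HP'; simpl in HP'.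
    pose proof (pi_body_eq G A A B (tr (env (A :: G)) B) (tr (env (A :: G)) B) HD
      (aeq_refl' _ _ _ _ HA) H HP' (HBs Hd)) as Hbody.
    destruct (aeq_valid _ _ _ _ _ Hbody) as (_ & Hbody' & _).
    pose proof (aeq_beta' U HUc _ _ _ _ _ Hbody' Hf) as Hbeta.
    rewrite (pi_body_sub1 m r) in Hbeta. exact Hbeta.
Qed.

Lemma tr_lam E A t :
  defined (rbar (ext (defined (rbar E A)) E) t) = true ->
  tr E (Lam A t) = bind Lam (mor E A) (rbar E A) (tr (ext (defined (rbar E A)) E) t).
Proof. intros H. unfold rval at 1; cbn [Defs.rbar]. now rewrite (tr_eq _ _ _ _ H). Qed.

Lemma tr_app E f a :
  defined (rbar E f) = true ->
  tr E (App f a) = bapp (defined (rbar E a)) (tr E f) (mor E a) (tr E a).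
Proof.
  intros H. unfold rval; cbn [Defs.rbar].
  destruct (rbar E f); try discriminate. now destruct (rbar E a).
Qed.

Lemma tr_pi E A B :
  defined (rbar (ext (defined (rbar E A)) E) B) = true ->
  tr E (Pi A B) = Lam (mor E (Pi A B))
    (pi_body m r E A (tr (ext (defined (rbar E A)) E) B)).
Proof.
  intros H. unfold rval at 1. now rewrite (rbar_pi m r HC), (tr_eq _ _ _ _ H).
Qed.

Lemma sem_pi G A A' B B' s :
  sort s -> awf U (rctx G) ->
  aeq T G (Pi A B) (Pi A' B') s -> aeq T G A A' (Some Typ) -> aeq T (A :: G) B B' s ->
  sem G A A' (Some Typ) -> sem (A :: G) B B' s -> sem G (Pi A B) (Pi A' B') s.
Proof.
  intros Hs HD EP EA EB HA HB.
  pose proof (sem_orel _ _ _ EA HA) as Ho.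
  pose proof (mor_eq T U m r HU HC HM _ _ _ _ HD EA) as EA'; simpl in EA'.
  pose proof (mor_eq T U m r HU HC HM _ _ _ _ HD EP) as EP'.
  assert (Eenv : env (A' :: G) = env (A :: G))
    by (rewrite !env_cons; now rewrite (env_cons_eq _ _ _ EA)).
  destruct (aeq_valid _ _ _ _ _ EB) as (_ & TB & TB').
  destruct Hs as [-> | ->].
  - simpl. intros f f' Hf.
    rewrite (env_cons_eq _ _ _ EA). apply bind_pi_eq; auto.
    apply HB. apply obj_app_typed; eauto using orel_refl_l.
  - intros Hd; simpl in Hd.
    assert (D : defined (rbar (env (A :: G)) B) = true)
      by (rewrite (defined_rdef _ _ _ TB); auto).
    assert (D' : defined (rbar (env (A :: G)) B') = true)
      by (rewrite (defined_rdef _ _ _ TB'), <- (rdef_eq _ _ _ _ EB); auto).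
    rewrite !tr_pi; rewrite <- ?env_cons, ?Eenv; auto.
    change (Rel (env G) Typ (mor (env G) (Pi A B)))
      with (Pi (mor (env G) (Pi A B)) Typ).
    apply aeq_lam'; auto. apply pi_body_eq; auto.
    apply (aeq_valid _ _ _ _ _ EP').
Qed.

Lemma sem_lam G A A' t t' B :
  awf U (rctx G) -> aeq T G A A' (Some Typ) -> aty T G A (Some Typ) ->
  aeq T (A :: G) t t' (Some B) ->
  sem G A A' (Some Typ) -> sem G A A (Some Typ) -> sem_ok (A :: G) B ->
  sem (A :: G) t t' (Some B) -> sem G (Lam A t) (Lam A' t') (Some (Pi A B)).
Proof.
  intros HD EA TA Et HA HAA HB Ht Hd.
  change (rdef (Lam A t) (Pi A B)) with (rdef t B) in Hd. specialize (Ht Hd).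
  pose proof (sem_orel _ _ _ EA HA) as Ho.
  pose proof (mor_eq T U m r HU HC HM _ _ _ _ HD EA) as EA'; simpl in EA'.
  assert (Eenv : env (A' :: G) = env (A :: G))
    by (rewrite !env_cons; now rewrite (env_cons_eq _ _ _ EA)).
  destruct (aeq_valid _ _ _ _ _ Et) as (_ & Tt & Tt').
  assert (TL : aty T G (Lam A t) (Some (Pi A B))) by (apply aty_lam'; auto).
  pose proof (mor_typed T U m r HU HC HM _ _ _ HD TL) as TL'; simpl in TL'.
  assert (D : defined (rbar (env (A :: G)) t) = true)
    by (rewrite (defined_rdef _ _ _ Tt); auto).
  assert (D' : defined (rbar (env (A :: G)) t') = true)
    by (rewrite (defined_rdef _ _ _ Tt'), <- (rdef_eq _ _ _ _ Et); auto).
  rewrite !tr_lam; rewrite <- ?env_cons, ?Eenv; auto.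
  pose proof (head_defined_cls _ _ _ Tt Hd) as HdB.
  destruct (Rel_pi _ _ _ _ HD TA HAA HB HdB TL') as (s & Hs & ER).
  eapply aeq_conv' with (s := s); [auto| |apply aeq_sym'; exact ER].
  assert (Ho' := orel_refl_l _ _ _ _ _ Ho).
  (* The body is typed over [x] alone. Since [mor_typed] would place it in a context that may
     contain [x^*], the typing is taken from [mbar_typed] and renamed. *)
  assert (TBt : aty U (mor (env G) A :: rctx G) (mor (ext false (env G)) t)
    (Some (mor (ext false (env G)) B))).
  { rewrite mor_lam, mor_pi in TL'.
    apply (mbar_typed T U m r HU HC HM) in Tt.
    assert (Hw : awf U (mor (env G) A :: rctx G))
      by (constructor; auto; apply (aeq_valid _ _ _ _ _ EA')).
    destruct Tt as [_ Tt].
    assert (Hok : ren_ok (mor (env G) A :: rctx G) (up_ren (obj (env G)))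
      (map (mbar m) (A :: G))) by (apply ren_ok_up, obj_ren_ok; auto).
    eapply annotated_ren in Tt; eauto. simpl in Tt.
    unfold Defs.mor at 2 3.
    rewrite !(ren_ext (obj (ext false (env G))) (up_ren (obj (env G))))
      by (intros [|i]; reflexivity).
    exact Tt. }
  (* The hypothesis on the body has its classifier at the image of [t], while [Rel_pi] puts it at
     the image of the abstraction applied to [x]. A beta step inside the classifier connects
     them. *)
  pose proof (obj_beta U HUc _ _ _ _ _ TBt Ho') as Hbeta. cbv zeta in Hbeta.
  rewrite <- mor_lam, <- !mor_ext, <- env_cons in Hbeta.
  destruct (Rel_ok_eq _ _ _ _ HB HdB (aeq_sym' _ _ _ _ _ Hbeta)) as (s' & Hs' & ER').
  eapply aeq_conv' with (s := s'); [auto| |].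
  - apply bind_lam_eq; eauto.
  - apply bind_pi_eq; auto. apply aeq_refl'; apply (aeq_valid _ _ _ _ _ EA').
Qed.

Lemma rdef_app f a A B :
  classifier T B -> rdef (App f a) (sub1 B a) = rdef f (Pi A B).
Proof.
  intros HB; unfold rdef, sub1. rewrite (classifier_sub T) by auto; simpl.
  destruct (kindly B) eqn:E; auto. apply head_defined_sub with T.
  destruct HB as [|[]]; auto.
Qed.

Lemma sem_ok_classifier G A : sem_ok G A -> classifier T A.
Proof. intros (s & Hs & HA & _). eapply aok_classifier, aok_some; eauto. Qed.

Lemma companion_typed G A a a' :
  aty T G A (Some Typ) -> aty T G a (Some A) -> sem G a a' (Some A) ->
  forall rA, rbar (env G) A = Some rA ->
  aeq U (rctx G) (tr (env G) a) (tr (env G) a') (Some (App rA (mor (env G) a))).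
Proof.
  intros TA Ta Ha rA HrA.
  assert (HK := family_not_kindly _ _ (aty_type _ _ _ TA)).
  assert (Hd : rdef a A = true).
  { unfold rdef; rewrite HK. rewrite <- rdef_type, <- (defined_rdef _ _ _ TA).
    now rewrite HrA. }
  specialize (Ha Hd). unfold rel_of in Ha. rewrite HK in Ha.
  now rewrite (tr_some _ _ _ _ _ HrA) in Ha.
Qed.

(** Term totality enters applications here: an argument has an image exactly when the binder expects
    one, so the translated function receives the right number of arguments. *)
Lemma defined_arg G A a :
  aty T G A (Some Typ) -> aty T G a (Some A) ->
  defined (rbar (env G) a) = defined (rbar (env G) A).
Proof.
  intros TA Ta. rewrite (defined_rdef _ _ _ TA), (defined_rdef _ _ _ Ta).
  unfold rdef; now rewrite (family_not_kindly _ _ (aty_type _ _ _ TA)).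
Qed.

Lemma Rel_sub1 G A B a f :
  aty T G A (Some Typ) -> aty T G a (Some A) -> classifier T B ->
  let b := defined (rbar (env G) A) in
  let sg := inst b (mor (env G) a) (tr (env G) a) in
  sub sg (Rel (env (A :: G)) B f) = Rel (env G) (sub1 B a) (sub sg f).
Proof.
  intros TA Ta HB b sg. unfold sg, b, sub1.
  rewrite env_cons, <- (defined_arg _ _ _ TA Ta).
  symmetry. eapply Rel_sub; eauto. apply env_sub1.
Qed.

Lemma sem_app G f f' a a' A B :
  awf U (rctx G) -> aty T G A (Some Typ) -> sem G A A (Some Typ) ->
  sem_ok (A :: G) B -> aeq T G f f' (Some (Pi A B)) -> aeq T G a a' (Some A) ->
  sem G f f' (Some (Pi A B)) -> sem G a a' (Some A) ->
  sem G (App f a) (App f' a') (Some (sub1 B a)).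
Proof.
  intros HD TA HA HB Ef Ea Hf Ha Hd.
  assert (HBc := sem_ok_classifier _ _ HB).
  rewrite rdef_app with (A := A) in Hd by auto. specialize (Hf Hd).
  destruct (aeq_valid _ _ _ _ _ Ef) as (_ & Tf & Tf').
  destruct (aeq_valid _ _ _ _ _ Ea) as (_ & Ta & Ta').
  pose proof (mor_typed T U m r HU HC HM _ _ _ HD Tf) as Tmf; simpl in Tmf.
  assert (HdB : head_defined r B = true) by exact (head_defined_cls _ _ _ Tf Hd).
  destruct (Rel_pi _ _ _ _ HD TA HA HB HdB Tmf) as (s & Hs & ER).
  apply (aeq_conv' _ _ _ _ _ _ _ Hs) with (2 := ER) in Hf.
  pose proof (defined_rdef _ _ _ Tf) as D. pose proof (defined_rdef _ _ _ Tf') as D'.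
  rewrite <- (rdef_eq _ _ _ _ Ef), Hd in D'. rewrite Hd in D.
  rewrite !tr_app by auto.
  rewrite (defined_arg _ _ _ TA Ta), (defined_arg _ _ _ TA Ta').
  pose proof (mor_eq T U m r HU HC HM _ _ _ _ HD Ea) as Ema.
  pose proof (bapp_eq U HUc _ _ _ _ _ _ _ _ _ _ Hf Ema
    (companion_typed _ _ _ _ TA Ta Ha)) as H.
  (* Instantiating the codomain turns the function applied to [x] into the image of the whole
     application, which is the index required by the goal. *)
  rewrite (Rel_sub1 _ _ _ _ _ TA Ta HBc) in H. cbn [sub] in H.
  rewrite bapp_obj_sub in H.
  replace (sub _ (obj_var _)) with (mor (env G) a) in H
    by now destruct (rbar (env G) A).
  exact H.
Qed.

Lemma sem_beta G A t B a :
  awf U (rctx G) -> aty T G A (Some Typ) -> sem G A A (Some Typ) ->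
  sem_ok (A :: G) B -> aty T (A :: G) t (Some B) -> aty T G a (Some A) ->
  sem (A :: G) t t (Some B) -> sem G a a (Some A) -> sem_ok G (sub1 B a) ->
  sem G (App (Lam A t) a) (sub1 t a) (Some (sub1 B a)).
Proof.
  intros HD TA HA HB Tt Ta Ht Ha HBa Hd.
  assert (HBc := sem_ok_classifier _ _ HB).
  rewrite rdef_app with (A := A) in Hd by auto.
  change (rdef (Lam A t) (Pi A B)) with (rdef t B) in Hd. specialize (Ht Hd).
  assert (D : defined (rbar (env (A :: G)) t) = true)
    by (rewrite (defined_rdef _ _ _ Tt); auto).
  assert (HdB : head_defined r (sub1 B a) = true).
  { unfold sub1; rewrite (head_defined_sub T).
    - exact (head_defined_cls _ _ _ Tt Hd).
    - destruct HBc as [|[]]; auto. }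
  pose proof (aeq_beta' T (proj1 HT) _ _ _ _ _ Tt Ta) as E.
  pose proof (mor_eq T U m r HU HC HM _ _ _ _ HD E) as Em.
  destruct (Rel_ok_eq _ _ _ _ HBa HdB (aeq_sym' _ _ _ _ _ Em)) as (s & Hs & ER).
  eapply aeq_conv' with (s := s); [auto| |exact ER].
  rewrite tr_app by (rewrite defined_rbar_lam, <- env_cons; auto).
  rewrite tr_lam by (rewrite <- env_cons; auto). rewrite <- env_cons.
  rewrite (defined_arg _ _ _ TA Ta).
  destruct (aeq_valid _ _ _ _ _ Ht) as (_ & Tt' & _).
  pose proof (mor_typed T U m r HU HC HM _ _ _ HD Ta) as Tma; simpl in Tma.
  assert (Hb := bind_beta U HUc _ _ _ _ _ _ (tr (env G) a) Tt' Tma).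
  rewrite (Rel_sub1 _ _ _ _ _ TA Ta HBc) in Hb.
  (* The target instantiation is the image of the source substitution, so the contractum in the
     target is the image of [sub1 t a]. *)
  assert (Hsub := env_sub1 m r (env G) a).
  rewrite (defined_arg _ _ _ TA Ta), <- env_cons in Hsub.
  rewrite <- (mor_sub m r HC _ _ _ _ t Hsub), <- (tr_sub m r HC _ _ _ _ t Hsub) in Hb.
  apply Hb. intros rA HrA.
  apply (aeq_valid _ _ _ _ _ (companion_typed _ _ _ _ TA Ta Ha _ HrA)).
Qed.

Lemma tr_eta_body b E f :
  defined (rbar E f) = true ->
  tr (ext b E) (App (lift f) (Var 0)) = bapp b (ren (wk b) (tr E f)) (obj_var b) (Var 0).
Proof.
  intros Hd. assert (W := env_ren_wk b E).
  rewrite tr_app.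
  - unfold lift; rewrite (tr_ren m r HC _ _ _ _ _ W). now destruct b.
  - unfold lift; rewrite (rbar_ren m r HC _ _ _ _ _ W).
    now destruct (rbar E f).
Qed.

Lemma sem_eta G A B f :
  awf U (rctx G) -> aty T G A (Some Typ) -> sem G A A (Some Typ) ->
  sem_ok (A :: G) B -> sem_ok G (Pi A B) -> aty T G f (Some (Pi A B)) ->
  sem G f f (Some (Pi A B)) ->
  sem G (Lam A (App (lift f) (Var 0))) f (Some (Pi A B)).
Proof.
  intros HD TA HA HB HP Tf Hf Hd.
  pose proof (aeq_eta' T (proj1 HT) _ _ _ _ Tf) as E.
  rewrite (rdef_eq _ _ _ _ E) in Hd. specialize (Hf Hd).
  assert (HdB := head_defined_cls _ _ _ Tf Hd).
  pose proof (mor_eq T U m r HU HC HM _ _ _ _ HD E) as Em.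
  pose proof (mor_typed T U m r HU HC HM _ _ _ HD Tf) as Tmf; simpl in Tmf.
  (* The classifier is moved from the expansion to [f], and then unfolded to a product over the
     bound variables, where [bind_eta] applies. *)
  destruct (Rel_ok_eq _ _ _ _ HP HdB (aeq_sym' _ _ _ _ _ Em)) as (s & Hs & ER).
  eapply aeq_conv' with (s := s); [auto| |exact ER].
  destruct (Rel_pi _ _ _ _ HD TA HA HB HdB Tmf) as (s' & Hs' & ER').
  eapply aeq_conv' with (s := s'); [auto| |apply aeq_sym'; exact ER'].
  destruct (aeq_valid _ _ _ _ _ Hf) as (_ & Tf' & _).
  apply (aty_conv' _ _ _ _ _ _ Hs') with (2 := ER') in Tf'.
  pose proof (defined_rdef _ _ _ Tf) as D. rewrite Hd in D.
  rewrite tr_lam.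
  - rewrite tr_eta_body by auto. now apply bind_eta.
  - rewrite defined_rbar_app. unfold lift.
    rewrite (rbar_ren m r HC _ _ _ _ _ (env_ren_wk _ _)). now destruct (rbar (env G) f).
Qed.

Lemma sem_var G i A :
  awf T G -> awf U (rctx G) -> nth_error G i = Some A ->
  sem G (Var i) (Var i) (Some (ren (fun j => S i + j) A)).
Proof.
  intros HG HD Hi. set (B := ren _ A).
  assert (HF : family T A = true) by (eapply level_of; eauto).
  intros Hd. assert (HK : kindly B = false).
  { unfold B; rewrite kindly_ren; eauto using family_not_kindly. }
  unfold rel_of, rdef in *; rewrite HK in *.
  unfold B in Hd. rewrite head_defined_ren in Hd.
  rewrite <- (star_defined T m r _ _ _ HG Hi) in Hd.
  destruct (star (env G) i) as [k|] eqn:Hk; try discriminate.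
  destruct (star_lookup m r HC _ _ _ _ Hi Hk) as (C & HC' & E). fold B in E.
  change (mor (env G) (Var i)) with (Var (obj (env G) i)). rewrite <- E.
  rewrite (tr_some m r (env G) (Var i) (Var k)) by (simpl; now rewrite Hk).
  apply aeq_refl', aty_var; auto. now apply awf_nth.
Qed.

(** The classifier is indexed by the image of the left side, so exchanging sides also requires
    conversion along the equation itself. *)
Lemma sem_sym G t u C :
  awf U (rctx G) -> (forall A, C = Some A -> sem_ok G A) ->
  aeq T G t u C -> sem G t u C -> sem G u t C.
Proof.
  intros HD HA E H. pose proof (mor_eq T U m r HU HC HM _ _ _ _ HD E) as Em.
  destruct C as [A|]; simpl in *.
  - intros Hd. rewrite <- (rdef_eq _ _ _ _ E) in Hd.
    destruct (aeq_valid _ _ _ _ _ E) as (_ & Tt & _).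
    destruct (Rel_ok_eq _ _ _ _ (HA _ eq_refl) (head_defined_cls _ _ _ Tt Hd) Em)
      as (s & Hs & ER).
    eapply aeq_conv' with (s := s); [auto| |exact ER]. apply aeq_sym'; auto.
  - intros f f' Hf. apply aeq_sym', H, aeq_sym'.
    eapply aeq_conv' with (s := None); [auto|exact Hf|]. now apply aeq_sym'.
Qed.

Lemma sem_trans G t u v C :
  awf U (rctx G) -> (forall A, C = Some A -> sem_ok G A) ->
  aeq T G t u C -> sem G t u C -> sem G u v C -> sem G t v C.
Proof.
  intros HD HA E H H'. pose proof (mor_eq T U m r HU HC HM _ _ _ _ HD E) as Em.
  destruct C as [A|]; simpl in *.
  - intros Hd. destruct (aeq_valid _ _ _ _ _ E) as (_ & Tt & _).
    destruct (Rel_ok_eq _ _ _ _ (HA _ eq_refl) (head_defined_cls _ _ _ Tt Hd) Em)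
      as (s & Hs & ER).
    rewrite (rdef_eq _ _ _ _ E) in Hd.
    apply aeq_trans' with (tr (env G) u); [apply H; now rewrite (rdef_eq _ _ _ _ E)|].
    eapply aeq_conv' with (s := s); [auto| |apply aeq_sym'; exact ER]. auto.
  - intros f f' Hf. apply aeq_trans' with (krel (env G) u f).
    + apply H, aeq_refl'. apply (aeq_valid _ _ _ _ _ Hf).
    + apply H'. eapply aeq_conv' with (s := None); [auto|exact Hf|auto].
Qed.

Lemma sem_conv G t u A A' s :
  sort s -> awf U (rctx G) -> aeq T G t u (Some A) -> aeq T G A A' s ->
  sem G t u (Some A) -> sem G A A' s -> sem G t u (Some A').
Proof.
  intros Hs HD Et EA Ht HA Hd.
  destruct (aeq_valid _ _ _ _ _ EA) as (_ & TA & TA').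
  destruct (aeq_valid _ _ _ _ _ Et) as (_ & Tt & _).
  assert (Hd' : rdef t A = true).
  { unfold rdef in *. rewrite (aty_sort_kindly _ _ _ _ _ Hs TA TA').
    now rewrite (head_defined_conv T U m r HR _ _ _ _ Hs EA). }
  eapply aeq_conv' with (s := s); [auto|now apply Ht|].
  apply Rel_eq; auto.
  - exact (head_defined_cls _ _ _ Tt Hd').
  - apply aeq_refl'. now apply (mor_typed T U m r HU HC HM _ _ (Some A)).
Qed.

(** Well-formedness of the translated context is repeated in every component because most rules have
    no premise about their context from which to obtain it. *)
Lemma fundamental :
  (forall G, awf T G -> awf U (rctx G)) /\
  (forall G C, aok T G C -> awf U (rctx G) /\ forall A, C = Some A -> sem_ok G A) /\
  (forall G t C, aty T G t C -> awf U (rctx G) /\ sem G t t C) /\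
  (forall G t u C, aeq T G t u C -> awf U (rctx G) /\ sem G t u C).
Proof.
  apply annotated_ind; intros;
    repeat match goal with H : _ /\ _ |- _ => destruct H end;
    try match goal with |- _ /\ _ => split; auto end;
    repeat match goal with H : forall A, Some ?B = Some A -> sem_ok ?G A |- _ =>
      specialize (H B eq_refl) end.
  - constructor.
  - rewrite rctx_cons. apply awf_bctx; auto.
    + now apply (mor_typed T U m r HU HC HM _ _ (Some Typ)).
    + now apply sem_orel; auto using aeq_refl'.
  - discriminate.
  - intros B E; injection E as <-. now exists s.
  - intros f f' Hf. simpl.
    apply aeq_pi'; auto. apply aeq_refl', aty_typ. constructor; auto.
    apply (aeq_valid _ _ _ _ _ Hf).
  - intros Hd. assert (Tc : aty T G (Const c) (Some A)) by now apply aty_const with d.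
    rewrite <- (defined_rdef _ _ _ Tc) in Hd.
    now apply (const_rel T U m r HT HU HC HR) with d.
  - now apply sem_var.
  - apply sem_pi; auto using aeq_refl', aty_pi.
  - apply sem_lam; auto using aeq_refl'.
  - apply sem_app with A; auto using aeq_refl'.
  - apply sem_conv with A s; auto using aeq_refl'.
  - apply sem_sym; auto.
  - apply sem_trans with u; auto.
  - apply sem_pi; auto. now apply aeq_pi.
  - apply sem_lam; auto.
  - apply sem_app with A; auto.
  - apply sem_beta; auto.
  - apply sem_eta; auto.
  - intros Hd. rewrite <- (defined_rdef G (Const c) A) in Hd by auto.
    now apply (delta_rel T U m r HT HU HC HR).
  - apply sem_conv with A s; auto.
Qed.

End Fundamental.

(** * Values outside the source theory *)

Fixpoint consts_in (T : theory) (e : expr) : Prop :=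
  match e with
  | Const c => lookup T c <> None
  | Var _ | Typ => True
  | Pi A B | Lam A B | App A B => consts_in T A /\ consts_in T B
  end.

Lemma annotated_consts T :
  (forall G, awf T G -> Forall (consts_in T) G) /\
  (forall G C, aok T G C -> forall A, C = Some A -> consts_in T A) /\
  (forall G t C, aty T G t C -> consts_in T t) /\
  (forall G t u C, aeq T G t u C -> True).
Proof.
  apply annotated_ind; simpl; auto; congruence.
Qed.

Section Agreement.

Variables (T : theory) (m m' : cname -> expr) (r r' : cname -> option expr).
Hypothesis Hm : forall c, lookup T c <> None -> m c = m' c.
Hypothesis Hr : forall c, lookup T c <> None -> r c = r' c.

Lemma mbar_agree e : consts_in T e -> mbar m e = mbar m' e.
Proof. induction e; simpl; intros H; f_equal; auto; apply IHe1 || apply IHe2; tauto. Qed.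

Lemma mor_agree E e : consts_in T e -> mor m E e = mor m' E e.
Proof. intros H; unfold mor; now rewrite mbar_agree. Qed.

Lemma rbar_agree E e : consts_in T e -> rbar m r E e = rbar m' r' E e.
Proof.
  revert E; induction e; intros E H; cbn [rbar]; auto; simpl in H.
  - rewrite IHe1, IHe2, (mor_agree _ e1), (mor_agree _ (Pi e1 e2)) by (simpl; tauto).
    reflexivity.
  - now rewrite IHe1, IHe2, mor_agree by tauto.
  - now rewrite IHe1, IHe2, mor_agree by tauto.
Qed.

Lemma renv_of_agree G : Forall (consts_in T) G -> renv_of m r G = renv_of m' r' G.
Proof. induction 1; simpl; auto. now rewrite IHForall, rbar_agree. Qed.

Lemma rctx_agree G : Forall (consts_in T) G -> rctx m r G = rctx m' r' G.
Proof.
  induction 1; simpl; auto.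
  now rewrite IHForall, renv_of_agree, rbar_agree, mor_agree.
Qed.

Hypothesis HT : valid_theory T.

Lemma declared_consts c A d :
  lookup T c = Some (A, d) ->
  lookup T c <> None /\ consts_in T A /\ forall t, d = Some t -> consts_in T t.
Proof.
  intros Hc; destruct (proj2 HT _ _ _ Hc) as [HA Ht]. split; [congruence|]. split.
  - eapply annotated_consts in HA; eauto.
  - intros t ->. specialize (Ht _ eq_refl). now apply annotated_consts in Ht.
Qed.

Lemma is_morphism_agree U : is_morphism T U m -> is_morphism T U m'.
Proof.
  intros H c A d Hc. destruct (declared_consts _ _ _ Hc) as (Hc' & HA & Hd).
  destruct (H _ _ _ Hc) as [H1 H2].
  rewrite <- Hm, <- mbar_agree by auto. split; auto.
  intros t ->. rewrite <- mbar_agree; auto.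
Qed.

Lemma partial_logrel_agree U : partial_logrel T U m r -> partial_logrel T U m' r'.
Proof.
  intros H c A d Hc. destruct (declared_consts _ _ _ Hc) as (Hc' & HA & Hd).
  destruct (H _ _ _ Hc) as [H1 H2].
  rewrite <- Hm, <- Hr, <- rbar_agree by auto. split; auto.
  intros t ->. rewrite <- rbar_agree by auto. apply H2; auto.
Qed.

Lemma term_total_agree : term_total T m r -> term_total T m' r'.
Proof.
  intros H c A d Hc HA. destruct (declared_consts _ _ _ Hc) as (Hc' & HA' & Hd).
  rewrite <- Hr, <- rbar_agree by auto. eapply H; eauto.
Qed.

End Agreement.

(* Outside the source theory, [m] and [r] may have open values, and then [rbar]
   does not commute with substitution. *)
Definition restrict_m (T : theory) (m : cname -> expr) (c : cname) : expr :=
  match lookup T c with Some _ => m c | None => Typ end.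

Definition restrict_r (T : theory) (r : cname -> option expr) (c : cname) : option expr :=
  match lookup T c with Some _ => r c | None => None end.

Lemma restrict_closed T U m r :
  is_morphism T U m -> partial_logrel T U m r ->
  closed_values (restrict_m T m) (restrict_r T r).
Proof.
  intros HM HR; unfold restrict_m, restrict_r; split; intros c.
  - destruct (lookup T c) as [[A d]|] eqn:Hc; [|intros s; reflexivity].
    destruct (HM _ _ _ Hc) as [H _]. eapply has_type_closed; eauto.
  - intros t Ht. destruct (lookup T c) as [[A d]|] eqn:Hc; [|discriminate].
    destruct (HR _ _ _ Hc) as [H _].
    destruct (H _ Ht) as (rA & _ & [H'|(K & _ & H')]); eapply has_type_closed; eauto.
Qed.

Lemma fundamental_term T U m r G t A rt rA :
  valid_theory T -> valid_theory U -> closed_values m r ->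
  is_morphism T U m -> partial_logrel T U m r -> term_total T m r ->
  aty T G t (Some A) ->
  rbar m r (renv_of m r G) t = Some rt -> rbar m r (renv_of m r G) A = Some rA ->
  has_type_red U (rctx m r G) rt (App rA (mor m (renv_of m r G) t)).
Proof.
  intros HT HU HC HM HR Htt Ht Hrt HrA.
  destruct (fundamental T U m r HT HU HC HM HR Htt) as (_ & _ & F & _).
  destruct (F _ _ _ Ht) as [_ H]. simpl in H.
  rewrite <- (defined_rdef T U m r HT HR Htt _ _ _ Ht), Hrt in H.
  specialize (H eq_refl). rewrite (tr_some _ _ _ _ _ Hrt) in H.
  destruct (aeq_valid _ _ _ _ _ H) as (_ & H' & _).
  apply annotated_sound in H'; simpl in H'. unfold rel_of in H'.
  destruct (kindly A) eqn:HA.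
  - right. eexists; split; [|exact H']. now apply krel_red.
  - left. now rewrite (tr_some _ _ _ _ _ HrA) in H'.
Qed.

Theorem theorem2 :
  forall (S T : theory) (m : cname -> expr) (r : cname -> option expr),
    wf_theory S -> wf_theory T ->
    is_morphism S T m -> partial_logrel S T m r ->
    (forall (G : ctx) (t A rt : expr),
       has_type S G t A ->
       rbar m r (renv_of m r G) t = Some rt ->
       exists rA : expr,
         rbar m r (renv_of m r G) A = Some rA /\
         (term_total S m r ->
          has_type_red T (rctx m r G) rt (App rA (mor m (renv_of m r G) t))))
    /\
    (term_total S m r ->
     forall (G : ctx) (t A : expr),
       has_type S G t A -> has_type S G A Typ ->
       rbar m r (renv_of m r G) A <> None ->
       rbar m r (renv_of m r G) t <> None)
    /\
    (const_total S m r ->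
     forall (G : ctx) (t A : expr),
       has_type S G t A ->
       rbar m r (renv_of m r G) A <> None ->
       rbar m r (renv_of m r G) t <> None).
Proof.
  intros S T m r HS HT HM HR.
  apply wf_theory_valid in HS, HT.
  destruct (annotated_complete S HS) as (_ & _ & Hann & _).
  (* The condition [kindly A = false] is used in place of a typing of [A], so that the claim also
     serves the case split in the last conjunct. *)
  assert (Htotal : term_total S m r -> forall G t A, aty S G t (Some A) ->
    kindly A = false -> rbar m r (renv_of m r G) A <> None ->
    rbar m r (renv_of m r G) t <> None).
  { intros Htt G t A Ht HA Hd. rewrite <- defined_iff in *.
    destruct (aok_classifier _ _ _ (aty_ok _ _ _ _ Ht)) as [|[_ HF]]; [congruence|].
    rewrite (defined_rbar S) in Hd by auto.
    eapply (defined_term_classifier S T m r HS HR) in Ht; eauto. now apply Ht. }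
  split; [|split].
  - intros G t A rt Ht Hrt. apply Hann in Ht.
    assert (Hd : defined (rbar m r (renv_of m r G) A) = true).
    { apply (defined_classifier S T m r HS HR G t A); auto. now rewrite Hrt. }
    apply defined_some in Hd as [rA HrA]. exists rA; split; auto. intros Htt.
    (* Everything in the derivation is built from constants of [S], so replacing [m] and [r] by
       their restrictions changes none of the images while making all values closed. *)
    assert (Em : forall c, lookup S c <> None -> m c = restrict_m S m c)
      by (intros c Hc; unfold restrict_m; destruct (lookup S c); congruence).
    assert (Er : forall c, lookup S c <> None -> r c = restrict_r S r c)
      by (intros c Hc; unfold restrict_r; destruct (lookup S c); congruence).
    pose proof (annotated_consts S) as (CG & CA & Ct & _).
    specialize (CG _ (aty_wf _ _ _ _ Ht)).
    specialize (CA _ _ (aty_ok _ _ _ _ Ht) _ eq_refl). specialize (Ct _ _ _ Ht).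
    rewrite (renv_of_agree _ _ _ _ _ Em Er) in * by auto.
    rewrite (rbar_agree _ _ _ _ _ Em Er) in Hrt, HrA by auto.
    rewrite (rctx_agree _ _ _ _ _ Em Er), (mor_agree _ _ _ Em) by auto.
    apply fundamental_term with (T := S) (A := A); auto.
    + now apply restrict_closed with T.
    + now apply is_morphism_agree with m.
    + now apply partial_logrel_agree with m r.
    + now apply term_total_agree with m r.
  - intros Htt G t A Ht HA. apply Htotal; auto.
    apply Hann in HA. eauto using family_not_kindly, aty_type.
  - intros Hct G t A Ht. apply Hann in Ht. destruct (kindly A) eqn:HA.
    + intros _. apply defined_iff. eapply const_total_defined; eauto.
      eapply aty_family; eauto.
    (* For constants whose classifier is a type, [const_total] gives [term_total]. *)
    + apply Htotal; auto. intros c B d Hc _. eapply Hct; eauto.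
Qed.
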